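(* Let $\mathcal{A}=\mathcal{A}_0+\mathsf{Y}\mathcal{A}_1+\cdots+\mathsf{Y}^d\mathcal{A}_d$ be a regular matrix polynomial with coefficients $\mathcal{A}_k\in\mathcal{C}^{n\times n}$, and let $a_k\in\mathbb{C}^{n\times n}$, $A_k\in\mathbb{R}_{\min}^{n\times n}$, $k=0,\dots,d$, be such that $(\mathcal{A}_{\epsilon,k})_{ij}\simeq(a_k)_{ij}\epsilon^{(A_k)_{ij}}$ for all $1\le i,j\le n$ and $0\le k\le d$. Denote by $A=A_0\oplus\mathsf{Y}A_1\oplus\cdots\oplus\mathsf{Y}^dA_d$ the associated min-plus matrix polynomial. Then $A$ is a regular matrix polynomial and we have: (1) $\operatorname{val}P_{\mathcal{A}_\epsilon}\ge\operatorname{val}P_A$, which means that if $+\infty$ is an eigenvalue of $A$ with multiplicity $m_{+\infty,A}$, then $0$ is an eigenvalue of $\mathcal{A}_\epsilon$ with multiplicity at least $m_{+\infty,A}$. (2) $\deg P_{\mathcal{A}_\epsilon}\le\deg P_A$, which means that if $-\infty$ is an eigenvalue of $A$ with multiplicity $m_{-\infty,A}$, then $\infty$ is an eigenvalue of $\mathcal{A}_\epsilon$ with multiplicity at least $m_{-\infty,A}$. (3) Let $\gamma$ be any finite ($\ne\pm\infty$) algebraic eigenvalue of $A$, and denote by $m_{\gamma,A}$ its multiplicity. Let $G$ be equal either to $\operatorname{Opt}(\widehat A(\gamma))$ or to $\operatorname{Sat}(\widehat A(\gamma),U,V)$, for any choice of the Hungarian pair $(U,V)$ with respect to $\widehat A(\gamma)$,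 and let $G_k=\mathcal{G}_k(A,\gamma)\cap G$ for all $0\le k\le d$. Assume that the matrix polynomial $$a^{(\gamma)}:=a_0^{G_0}+\mathsf{Y}a_1^{G_1}+\cdots+\mathsf{Y}^da_d^{G_d}$$ is regular. Let $m_\gamma\ge0$ be the number of non-zero eigenvalues of the matrix polynomial $a^{(\gamma)}$ and let $\lambda_1,\dots,\lambda_{m_\gamma}$ be these eigenvalues. Then $m_\gamma\le m_{\gamma,A}$ and the matrix polynomial $\mathcal{A}_\epsilon$ has $m_\gamma$ eigenvalues $\mathcal{L}_{\epsilon,1},\dots,\mathcal{L}_{\epsilon,m_\gamma}$ with first order asymptotics of the form $\mathcal{L}_{\epsilon,i}\sim\lambda_i\epsilon^\gamma$. Let $m'_{\gamma,A}$ be the sum of the multiplicities of all the algebraic eigenvalues of $A$ greater than $\gamma$ ($+\infty$ included), with $m'_{\gamma,A}=0$ if no such eigenvalues exist, and let $m''_{\gamma,A}=nd-m_{\gamma,A}-m'_{\gamma,A}$. Let $m'_\gamma=\operatorname{val}\det(a^{(\gamma)})$ be the multiplicity of $0$ as an eigenvalue of $a^{(\gamma)}$, with $m'_\gamma=0$ if $0$ is not an eigenvalue. Let also $m''_\gamma=nd-m_\gamma-m'_\gamma$ be the multiplicity of $\infty$ as an eigenvalue of $a^{(\gamma)}$, considered as a matrix polynomial of degree $d$. Then $m'_\gamma\ge m'_{\gamma,A}$ (resp. $m''_\gamma\ge m''_{\gamma,A}$) and the matrix polynomial $\mathcal{A}_\epsilon$ has precisely $m'_\gamma$ (resp. $m''_\gamma$)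 eigenvalues $\mathcal{L}_\epsilon$ such that $\mathcal{L}_\epsilon\simeq0\,\epsilon^\gamma$ (resp. $\mathcal{L}_\epsilon^{-1}\simeq0\,\epsilon^{-\gamma}$, that is, the modulus of $\epsilon^{-\gamma}\mathcal{L}_\epsilon$ converges to infinity).
   Context: **Germs and asymptotics.** $\mathcal{C}$ is the ring of germs at $0^+$ of continuous functions $f:(0,\epsilon_0)\to\mathbb{C}$ (some $\epsilon_0>0$) such that $|f(\epsilon)|\le\epsilon^{-k}$ on $(0,\epsilon_0)$ for some constant $k>0$ (functions coinciding near $0$ are identified). For $f\in\mathcal{C}$, $a\in\mathbb{C}$, $A\in\mathbb{R}\cup\{+\infty\}$: $f(\epsilon)\simeq a\epsilon^A$ means $\lim_{\epsilon\to0^+}\epsilon^{-A}f(\epsilon)=a$ if $A\in\mathbb{R}$, and $f=0$ (near $0$) if $A=+\infty$. One says that $f$ has first order asymptotics, $f\sim a\epsilon^A$, if $f\simeq a\epsilon^A$ and either $A\in\mathbb{R}$, $a\ne0$, or $A=+\infty$. $\mathcal{A}_{\epsilon,k}$ and $\mathcal{A}_\epsilon$ are the values at $\epsilon$ of $\mathcal{A}_k$ and $\mathcal{A}$. **Eigenvalues of matrix polynomials.** A matrix polynomial $\mathcal{A}=\sum_{k=0}^d\mathsf{Y}^k\mathcal{A}_k$ of size $n$ (over $\mathcal{C}$ or $\mathbb{C}$) is regular if $\det\mathcal{A}$ is not identically zero. $P_{\mathcal{A}_\epsilon}:=\det(\mathcal{A}_\epsilon)$; its roots are the eigenvalues of $\mathcal{A}_\epsilon$,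 and if its degree is $<nd$, $\infty$ is also an eigenvalue, with multiplicity $nd$ minus the degree. Eigenvalues are counted with multiplicities. $\operatorname{val}$ and $\deg$ of a polynomial are the smallest and largest exponents with non-zero coefficient (coefficient $\ne+\infty$ in the min-plus case). **Min-plus algebra.** $\mathbb{R}_{\min}=\mathbb{R}\cup\{+\infty\}$ is the min-plus semifield: $a\oplus b=\min(a,b)$, product $ab=a+b$ (usual sum), zero $+\infty$, unit $0$. For a formal polynomial $P$ over $\mathbb{R}_{\min}$ of degree $N$, the function $\widehat P(y)=\min_k(P_k+ky)$ (the term $k=0$ being $P_0$) factors uniquely as $P_N+\sum_{i=1}^N\min(y,c_i)$ with $c_1\le\cdots\le c_N$ in $\mathbb{R}_{\min}$; the $c_i$ are the roots of $P$, with multiplicity the number of occurrences. For $B\in\mathbb{R}_{\min}^{n\times n}$, $|\sigma|_B=\sum_iB_{i\sigma(i)}$ for a permutation $\sigma$ of $[n]=\{1,\dots,n\}$, and $\operatorname{per}B=\min_\sigma|\sigma|_B$. For the min-plus matrix polynomial $A$, $P_A=\operatorname{per}A\in\mathbb{R}_{\min}[\mathsf{Y}]$ is the min-plus permanent of the matrix with entries $A_{ij}=\bigoplus_k(A_k)_{ij}\mathsf{Y}^k$; i.e. $(P_A)_\ell=\min\sum_i(A_{k_i})_{i\sigma(i)}$ over permutations $\sigma$ of $[n]$ and $k_1,\dots,k_n\in\{0,\dots,d\}$ with $\sum_i k_i=\ell$. $A$ is regular if $P_A$ is not identically $+\infty$. Then its algebraic eigenvalues are the roots of $P_A$; $+\infty$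 is an eigenvalue with multiplicity $\operatorname{val}P_A$ when $\operatorname{val}P_A>0$; when $\deg P_A<nd$, one says that $-\infty$ is an eigenvalue with multiplicity $nd-\deg P_A$. $\widehat A(\gamma)\in\mathbb{R}_{\min}^{n\times n}$ is the matrix with entries $\widehat A_{ij}(\gamma)=\min_k((A_k)_{ij}+k\gamma)$. **Graphs.** All graphs are directed with node set $[n]$. For $B\in\mathbb{R}_{\min}^{n\times n}$ with $\operatorname{per}B\ne+\infty$: $\operatorname{Opt}(B)$ has an arc $(i,j)$ iff there is a permutation $\sigma$ with $j=\sigma(i)$ and $|\sigma|_B=\operatorname{per}B$. A Hungarian pair with respect to $B$ is a pair $U,V\in\mathbb{R}^n$ with $B_{ij}\ge U_i+V_j$ for all $i,j$ and $\sum_iU_i+\sum_jV_j=\operatorname{per}B$. $\operatorname{Sat}(B,U,V)$ has an arc $(i,j)$ iff $B_{ij}=U_i+V_j$. $\mathcal{G}_k(A,\gamma)$ has an arc $(i,j)$ iff $k\gamma+(A_k)_{ij}=\widehat A_{ij}(\gamma)\ne+\infty$. $G\cap G'$ is the graph whose arcs are the common arcs. For $b\in\mathbb{C}^{n\times n}$ and a graph $G$, $b^G$ is the matrix with $(b^G)_{ij}=b_{ij}$ if $(i,j)$ is an arc of $G$ and $(b^G)_{ij}=0$ otherwise. *)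

(* Defs.v *)
From HB Require Import structures.
From mathcomp Require Import all_boot all_order all_algebra all_fingroup.
From mathcomp Require Import complex.
From mathcomp Require Import boolp classical_sets functions reals ereal.
From mathcomp Require Import topology normedtype exp.

Set Implicit Arguments.
Unset Strict Implicit.
Unset Printing Implicit Defensive.

Import Order.TTheory GRing.Theory Num.Theory.
Import numFieldNormedType.Exports.

Local Open Scope classical_set_scope.
Local Open Scope ring_scope.

(* Packing R[i] as a numClosedFieldType gives it the topology of its modulus. *)
Definition Cplx (R : realType) : numClosedFieldType := R[i].

Definition cplx_of_real (R : realType) (x : R) : Cplx R := (x%:C)%C.

Section Germs.
Variable R : realType.
Local Notation C := (Cplx R).

(* Germs at 0^+ are handled through representatives R -> C: only the values
   on some ]0, e0[ matter, and equality of germs is equality near 0^'+. *)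
Definition in_germ_ring (f : R -> C) : Prop :=
  exists e0 k : R, [/\ 0 < e0, 0 < k,
    {in `]0, e0[, continuous f} &
    {in `]0, e0[, forall e, `|f e| <= cplx_of_real (e `^ (- k))}].

Definition simeq (f : R -> C) (a : C) (A : \bar R) : Prop :=
  match A with
  | r%:E => (cplx_of_real (e `^ (- r)) * f e) @[e --> 0^'+] --> a
  | +oo%E => \forall e \near 0^'+, f e = 0
  | -oo%E => False
  end.

Definition first_order (f : R -> C) (a : C) (A : \bar R) : Prop :=
  simeq f a A /\ (A \is a fin_num -> a != 0).

End Germs.

Section ComplexMatrixPolynomials.
Variables (R : realType) (n d : nat).
Local Notation C := (Cplx R).

(* A matrix polynomial of degree at most d is the family of its d.+1
   coefficients. *)
Definition matpoly (a : 'I_d.+1 -> 'M[C]_n) : 'M[{poly C}]_n :=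
  \sum_(k < d.+1) 'X^k *: map_mx polyC (a k).

Definition charp (a : 'I_d.+1 -> 'M[C]_n) : {poly C} := \det (matpoly a).

Definition regular (a : 'I_d.+1 -> 'M[C]_n) : Prop := charp a != 0.

(* Smallest exponent with a non-zero coefficient; meaningful for p != 0. *)
Definition poly_val (p : {poly C}) : nat := find (fun c => c != 0) p.

Definition poly_deg (p : {poly C}) : nat := (size p).-1.

(* The roots of p with multiplicities; meaningful for p != 0. *)
Definition proots (p : {poly C}) : seq C := sval (closed_field_poly_normal p).

(* Eigenvalues with multiplicities on the projective line: None is the
   infinite eigenvalue. *)
Definition eigenvalues (a : 'I_d.+1 -> 'M[C]_n) : seq (option C) :=
  map Some (proots (charp a)) ++ nseq (n * d - poly_deg (charp a)) None.

Definition nonzero_eigenvalues (a : 'I_d.+1 -> 'M[C]_n) : seq C :=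
  [seq z <- proots (charp a) | z != 0].

(* Inversion of the projective line (in C itself, 0^-1 = 0). *)
Definition proj_inv (x : option C) : option C :=
  match x with
  | None => Some 0
  | Some z => if z == 0 then None else Some z^-1
  end.

(* A coefficient of \det of a polynomial over the ring of germs is zero iff it
   vanishes near 0^'+, and there are finitely many of them. *)
Definition germ_regular (F : 'I_d.+1 -> R -> 'M[C]_n) : Prop :=
  ~ (\forall e \near 0^'+, charp (fun k => F k e) = 0).

Definition mx_restrict (b : 'M[C]_n) (G : rel 'I_n) : 'M[C]_n :=
  \matrix_(i, j) if G i j then b i j else 0.

End ComplexMatrixPolynomials.

Section Branches.
Variable R : realType.
Local Notation C := (Cplx R).

(* Asymptotics of a branch of eigenvalues L with values in the projective
   line. *)
Definition branch_first_order (L : R -> option C) (a : C) (r : R) : Prop :=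
  exists f : R -> C, [/\ in_germ_ring f,
    (\forall e \near 0^'+, L e = Some (f e)) & first_order f a r%:E].

Definition branch_small (L : R -> option C) (r : R) : Prop :=
  exists f : R -> C, [/\ in_germ_ring f,
    (\forall e \near 0^'+, L e = Some (f e)) & simeq f 0 r%:E].

Definition branch_large (L : R -> option C) (r : R) : Prop :=
  branch_small (fun e => proj_inv (L e)) (- r).

End Branches.

(* R_min is the part of \bar R above -oo, zero being +oo and unit 0. *)
Section MinPlus.
Variable R : realType.
Local Open Scope ereal_scope.

(* A formal min-plus polynomial is the list of its coefficients, in increasing
   order of the exponents; trailing +oo are allowed. *)
Definition mp_val (P : seq (\bar R)) : nat := find (fun c => c != +oo) P.

Definition mp_deg (P : seq (\bar R)) : nat :=
  (\max_(l < size P | nth +oo P l != +oo) l)%N.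

(* For l = 0 the term is P_0 even at y = +oo, because 0 * +oo = 0. *)
Definition mp_eval (P : seq (\bar R)) (y : \bar R) : \bar R :=
  \big[Order.min/+oo]_(l < size P) (nth +oo P l + l%:R%:E * y).

Definition mp_factors (P c : seq (\bar R)) : Prop :=
  [/\ size c = mp_deg P,
      sorted <=%O c,
      all (fun x => -oo < x) c &
      forall y : \bar R, -oo < y ->
        mp_eval P y = nth +oo P (mp_deg P) + \sum_(x <- c) Order.min y x].

Definition mp_roots (P : seq (\bar R)) : seq (\bar R) :=
  xget [::] [set c | mp_factors P c].

Variable n : nat.

Definition mp_weight (B : 'M[\bar R]_n) (s : 'S_n) : \bar R :=
  \sum_(i < n) B i (s i).

Definition mp_per (B : 'M[\bar R]_n) : \bar R :=
  \big[Order.min/+oo]_(s : 'S_n) mp_weight B s.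

Definition Opt (B : 'M[\bar R]_n) : rel 'I_n :=
  fun i j => [exists s : 'S_n, (j == s i) && (mp_weight B s == mp_per B)].

Definition hungarian_pair (B : 'M[\bar R]_n) (U V : 'rV[R]_n) : Prop :=
  (forall i j, (U 0%R i + V 0%R j)%:E <= B i j) /\
  (\sum_(i < n) U 0 i + \sum_(j < n) V 0 j)%R%:E = mp_per B.

Definition Sat (B : 'M[\bar R]_n) (U V : 'rV[R]_n) : rel 'I_n :=
  fun i j => B i j == (U 0%R i + V 0%R j)%:E.

Variable d : nat.
Implicit Types A : 'I_d.+1 -> 'M[\bar R]_n.

Definition mp_charp A : seq (\bar R) :=
  mkseq (fun l => \big[Order.min/+oo]_(s : 'S_n)
    \big[Order.min/+oo]_(k : {ffun 'I_n -> 'I_d.+1} | (\sum_(i < n) k i)%N == l)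
      \sum_(i < n) A (k i) i (s i)) (n * d).+1.

Definition mp_regular A : Prop := has (fun c => c != +oo) (mp_charp A).

(* -oo occurs n * d - deg P_A times. *)
Definition mp_eigenvalues A : seq (\bar R) :=
  mp_roots (mp_charp A) ++ nseq (n * d - mp_deg (mp_charp A)) -oo.

Definition mp_hat A (g : R) : 'M[\bar R]_n :=
  \matrix_(i, j) \big[Order.min/+oo]_(k < d.+1) (A k i j + (k%:R * g)%:E).

Definition mp_graph A (g : R) (k : 'I_d.+1) : rel 'I_n :=
  fun i j => ((k%:R * g)%:E + A k i j == mp_hat A g i j)
             && (mp_hat A g i j != +oo).

End MinPlus.

(* Main.v *)
(** Fix a finite root g of P_A. Replacing Y by e^g Y and dividing by e^(per),
    where per is the permanent of the matrix A^(g), turns det(A_e) into a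
    polynomial whose coefficients converge to those of det(a^(g)): in the
    expansion over permutations and choices of degrees, a term survives exactly
    when its weight equals per, that is when all its arcs lie in the graphs G_k.
    For Opt this uses that a permutation made of arcs of optimal permutations is
    optimal, because circulations decompose into cycles of non-negative relative
    weight. The coordinate 1 / (y - w), where w is not a root of the limit, makes
    all the projective eigenvalues finite, so that they become the n d roots of
    monic polynomials depending continuously on e, up to e = 0. These roots can
    be chosen as continuous branches: orderings built by greedy matching along
    finer and finer grids converge along an ultrafilter, and near a given time
    small jumps cannot leave a cluster of roots. The inequalities on
    multiplicities compare the slopes of the concave piecewise affine function
    y |-> min_l ((P_A)_l + l y) on both sides of g. *)

Require Import Defs.
From HB Require Import structures.
From mathcomp Require Import all_boot all_order all_algebra all_fingroup.
From mathcomp Require Import complex.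
From mathcomp Require Import boolp classical_sets functions reals ereal.
From mathcomp Require Import topology normedtype exp.
From mathcomp Require Import sequences ring lra zify.

Import Order.TTheory GRing.Theory Num.Theory.
Import numFieldNormedType.Exports.

Local Open Scope classical_set_scope.
Local Open Scope ring_scope.

Set Implicit Arguments.
Unset Strict Implicit.

(** * Continuity of roots *)

Lemma nearest_mem (K : numFieldType) (a y : K) (s : seq K) :
  exists2 z, z \in y :: s & {in y :: s, forall x, `|a - z| <= `|a - x|}.
Proof.
elim: s y => [|x s IH] y; first by exists y; rewrite ?inE // => u; rewrite !inE => /eqP ->.
have [z zs zmin] := IH x.
have [le|le] := real_leP (normr_real (a - z)) (normr_real (a - y)).
  exists z; first by rewrite inE zs orbT.
  by move=> u; rewrite inE => /predU1P[->|/zmin].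
exists y; first exact: mem_head.
by move=> u; rewrite inE => /predU1P[->//|/zmin]; apply: le_trans (ltW le).
Qed.

Lemma cvg_sumr (K : numFieldType) (T : Type) (F : set_system T) {FF : Filter F}
    (I : Type) (r : seq I) (P : pred I) (f : I -> T -> K) (l : I -> K) :
  (forall i, P i -> f i x @[x --> F] --> l i) ->
  \sum_(i <- r | P i) f i x @[x --> F] --> \sum_(i <- r | P i) l i.
Proof. by move=> fl; apply: cvg_big => //; exact: add_continuous. Qed.

Lemma cvg_prodr (K : numFieldType) (T : Type) (F : set_system T) {FF : Filter F}
    (I : Type) (r : seq I) (P : pred I) (f : I -> T -> K) (l : I -> K) :
  (forall i, P i -> f i x @[x --> F] --> l i) ->
  \prod_(i <- r | P i) f i x @[x --> F] --> \prod_(i <- r | P i) l i.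
Proof. by move=> fl; apply: cvg_big => //; exact: mul_continuous. Qed.

Lemma cvg_horner (K : numFieldType) (T : Type) (F : set_system T) {FF : Filter F}
    (p : T -> {poly K}) (q : {poly K}) (N : nat) (x : K) :
  (forall t, (size (p t) <= N)%N) -> (size q <= N)%N ->
  (forall k, (p t)`_k @[t --> F] --> q`_k) -> (p t).[x] @[t --> F] --> q.[x].
Proof.
move=> sp sq pq; rewrite (horner_coef_wide _ sq).
rewrite (_ : (fun t => (p t).[x]) = (fun t => \sum_(i < N) (p t)`_i * x ^+ i)).
  by apply: cvg_sumr => i _; apply: cvgM => //; exact: cvg_cst.
by apply/funext => t; rewrite (horner_coef_wide _ (sp t)).
Qed.

(** The modulus of the value at [r0] is the product of the [(size r).+1] distances from [r0] to the
    roots. It tends to 0 and bounds the corresponding power of the smallest distance, so the nearest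
    root works. *)
Lemma near_root_of_coef (K : numFieldType) (T : Type) (F : set_system T) {FF : Filter F}
    (ro : T -> seq K) (r0 : K) (r : seq K) :
  (forall t, size (ro t) = (size r).+1) ->
  (forall k, (\prod_(z <- ro t) ('X - z%:P))`_k @[t --> F]
             --> (\prod_(z <- r0 :: r) ('X - z%:P))`_k) ->
  exists2 z : T -> K, (forall t, z t \in ro t) & z t @[t --> F] --> r0.
Proof.
move=> sro coefs.
have /choice[z zP] t : exists z, z \in ro t /\ {in ro t, forall x, `|r0 - z| <= `|r0 - x|}.
  case: (ro t) (sro t) => // y s _.
  by have [z z1 z2] := nearest_mem r0 y s; exists z.
exists z => [t|]; first by case: (zP t).
have h0 : (\prod_(z <- ro t) ('X - z%:P)).[r0] @[t --> F] --> 0.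
  rewrite -[0](_ : (\prod_(z <- r0 :: r) ('X - z%:P)).[r0] = 0).
    by apply: (@cvg_horner _ _ _ _ _ _ (size r).+2) => // [t|];
      rewrite size_prod_XsubC ?sro.
  by rewrite big_cons hornerM hornerXsubC subrr mul0r.
apply/cvgrPdist_lt => e e0.
have e'0 : 0 < e ^+ (size r).+1 by apply: exprn_gt0.
move/cvgrPdist_lt: h0 => /(_ _ e'0) h0.
near=> t.
have : `|(\prod_(z <- ro t) ('X - z%:P)).[r0]| < e ^+ (size r).+1.
  by rewrite -normrN -[- _]add0r; near: t.
apply: contraPT; rewrite -real_leNgt ?normr_real ?gtr0_real// => ze.
apply/negP; rewrite -real_leNgt ?normr_real ?gtr0_real//.
rewrite horner_prod normr_prod -(sro t) -[X in _ ^+ X]subn0 -prodr_const_nat [leRHS](big_nth 0).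
rewrite big_nat_cond [leRHS]big_nat_cond.
apply: ler_prod => i /andP[/andP[_ ilt] _]; rewrite ltW//= hornerXsubC.
by apply: (le_trans ze); apply: (proj2 (zP t)); exact: mem_nth.
Unshelve. all: by end_near. Qed.

(* Dividing by the factor X - z expresses the coefficients of the quotient by
   descending recursion, hence continuously. *)
Lemma cvg_coef_divXsub (K : numFieldType) (T : Type) (F : set_system T) {FF : Filter F}
    (z : T -> K) (z0 : K) (u : T -> {poly K}) (v : {poly K}) (N : nat) :
  (forall t, (size (u t) <= N)%N) -> (size v <= N)%N ->
  z t @[t --> F] --> z0 ->
  (forall k, (('X - (z t)%:P) * u t)`_k @[t --> F] --> (('X - z0%:P) * v)`_k) ->
  forall k, (u t)`_k @[t --> F] --> v`_k.
Proof.
move=> su sv zz0 puv.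
have key m : forall k, (N <= k + m)%N -> (u t)`_k @[t --> F] --> v`_k.
  elim: m => [|m IH] k.
    rewrite addn0 => Nk; rewrite (nth_default _ (leq_trans sv Nk)).
    rewrite (_ : (fun t => _) = cst 0); first exact: cvg_cst.
    by apply/funext => t; rewrite (nth_default _ (leq_trans (su t) Nk)).
  rewrite addnS -addSn => /IH uk.
  have E (y : K) (w : {poly K}) : w`_k = (('X - y%:P) * w)`_k.+1 + y * w`_k.+1.
    by rewrite mulrBl coefB coefXM coefCM /= subrK.
  rewrite (E z0 v) (_ : (fun t => _) =
    (fun t => (('X - (z t)%:P) * u t)`_k.+1 + z t * (u t)`_k.+1)).
    by apply: cvgD => //; apply: cvgM.
  by apply/funext => t; exact: E.
by move=> k; apply: (key N); rewrite leq_addl.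
Qed.

(** Induction on the limit roots: a root tending to [r0] is split off, and the coefficients of the
    quotient still converge. *)
Lemma cvg_roots (K : numFieldType) (T : Type) (F : set_system T) {FF : Filter F}
    (ro : T -> seq K) (r : seq K) :
  (forall t, size (ro t) = size r) ->
  (forall k, (\prod_(z <- ro t) ('X - z%:P))`_k @[t --> F]
             --> (\prod_(z <- r) ('X - z%:P))`_k) ->
  exists2 ro' : T -> seq K, (forall t, perm_eq (ro' t) (ro t)) &
    forall i, (ro' t)`_i @[t --> F] --> r`_i.
Proof.
elim: r ro => [|r0 r IH] ro sro coefs.
  exists (fun=> [::]) => [t|i]; last by rewrite !nth_nil; exact: cvg_cst.
  by rewrite (size0nil (sro t)).
have [z zro zcvg] := near_root_of_coef sro coefs.
have pro t := perm_to_rem (zro t).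
have srem t : size (rem (z t) (ro t)) = size r by rewrite size_rem// sro.
have [|ro' ro'P ro'cvg] := IH (fun t => rem (z t) (ro t)) srem; last first.
  exists (fun t => z t :: ro' t) => [t|[|i] /=]; last 2 first.
  - exact: zcvg.
  - exact: ro'cvg.
  by rewrite (permPr (pro t)) perm_cons.
apply: (cvg_coef_divXsub (N := (size r).+1) _ _ zcvg) => // [t||k].
- by rewrite size_prod_XsubC srem.
- by rewrite size_prod_XsubC.
move: (coefs k); rewrite big_cons.
rewrite (_ : (fun t => (\prod_(z <- ro t) ('X - z%:P))`_k) =
  fun t => (('X - (z t)%:P) * \prod_(z <- rem (z t) (ro t)) ('X - z%:P))`_k) //.
by apply/funext => t; rewrite (perm_big _ (pro t)) big_cons.
Qed.

(** * Continuous branches of roots *)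

Section ComplexNorm.
Variable R : realType.
Local Notation C := (Cplx R).

Definition normR (x : C) : R := complex.Re `|x|.

Lemma normRE (x : C) : `|x| = cplx_of_real (normR x).
Proof. by rewrite /cplx_of_real /normR RRe_real// normr_real. Qed.

Lemma ltc_of_real (x y : R) : (cplx_of_real x < cplx_of_real y) = (x < y).
Proof. exact: ltcR. Qed.

Lemma lec_of_real (x y : R) : (cplx_of_real x <= cplx_of_real y) = (x <= y).
Proof. exact: lecR. Qed.

Lemma gt0_cplx_of_real (e : C) : 0 < e -> exists2 r : R, 0 < r & e = cplx_of_real r.
Proof.
move=> e0; have re : e = cplx_of_real (complex.Re e).
  by rewrite /cplx_of_real RRe_real// gtr0_real.
by exists (complex.Re e) => //; rewrite -ltc_of_real -re.
Qed.

Lemma normR_lt (x : C) (e : R) : (`|x| < cplx_of_real e) = (normR x < e).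
Proof. by rewrite normRE ltc_of_real. Qed.

Lemma normR_ge0 (x : C) : 0 <= normR x.
Proof. by rewrite -lec_of_real -normRE normr_ge0. Qed.

Lemma normR0_eq0 (x : C) : normR x = 0 -> x = 0.
Proof. by move=> x0; apply/eqP; rewrite -normr_eq0 normRE x0. Qed.

Lemma normR_distC (x y : C) : normR (x - y) = normR (y - x).
Proof. by rewrite /normR distrC. Qed.

Lemma normR_distD (z x y : C) : normR (x - y) <= normR (x - z) + normR (z - y).
Proof.
rewrite -lec_of_real /cplx_of_real rmorphD /= -!/(cplx_of_real _) -!normRE.
exact: ler_distD.
Qed.

End ComplexNorm.

(** * Greedy matching of roots along grids of times *)

Section Selection.
Variables (R : realType) (N : nat).
Local Notation C := (Cplx R).
Implicit Types (v w r : 'I_N -> C).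

(** A permutation minimizing the largest distance is as good as any other one, for all thresholds
    [e] at once. *)
Lemma best_matching v w : exists s : 'S_N, forall (s' : 'S_N) (e : R),
  (forall i, normR (v i - w (s' i)) < e) -> forall i, normR (v i - w (s i)) < e.
Proof.
pose dist (s : 'S_N) := \big[Order.max/0]_i normR (v i - w (s i)).
exists [arg min_(s < 1%g) dist s]%O => s' e lte i.
case: arg_minP => // s _ /(_ s' isT) smin.
apply: le_lt_trans (_ : dist s < e).
  by rewrite /dist (le_bigmax _ (fun i => normR (v i - w (s i)))).
apply: le_lt_trans smin _; apply: bigmax_lt => //.
(* The maximum starts at 0, so [0 < e] is required; the index [i] provides it. *)
exact: le_lt_trans (normR_ge0 _) (lte i).
Qed.

Lemma cvg_roots_perm (T : Type) (F : set_system T) {FF : Filter F}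
    (ro : T -> 'I_N -> C) (r : 'I_N -> C) :
  (forall k, (\prod_i ('X - (ro t i)%:P))`_k @[t --> F]
             --> (\prod_i ('X - (r i)%:P))`_k) ->
  exists s : T -> 'S_N, forall i, ro t (s t i) @[t --> F] --> r i.
Proof.
move=> coefs.
have prodE (v : 'I_N -> C) :
    \prod_(z <- [tuple v i | i < N]) ('X - z%:P) = \prod_i ('X - (v i)%:P).
  by rewrite big_tuple; apply: eq_bigr => i _; rewrite tnth_mktuple.
have [t||ro' pro' cro'] := @cvg_roots C T F FF (fun t => [tuple ro t i | i < N])
  [tuple r i | i < N]; first by rewrite !size_tuple.
  move=> k; rewrite prodE (_ : (fun t => _) = fun t => (\prod_i ('X - (ro t i)%:P))`_k) //.
  by apply/funext => t; rewrite prodE.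
have /choice[s sP] t : exists s : 'S_N, forall i : 'I_N, (ro' t)`_i = ro t (s i).
  have /tuple_permP[s sE] := pro' t; exists s => i.
  by rewrite sE -tnth_nth !tnth_mktuple.
exists s => i; have := cro' i; rewrite -tnth_nth tnth_mktuple.
by rewrite (_ : (fun t => (ro' t)`_i) = fun t => ro t (s t i)) //; apply/funext => t.
Qed.

(** Otherwise the complements of all the fibres belong to [U], and so does their finite
    intersection, which is empty. *)
Lemma ultra_finite (T : Type) (U : set_system T) (S : finType) (f : T -> S) :
  UltraFilter U -> exists x, U [set t | f t = x].
Proof.
move=> UU; apply: contrapT => nex.
have : U (fun t => forall x, f t <> x).
  apply: filter_forall => x.
  have [//|//] := in_ultra_setVsetC [set t | f t = x] UU.
  by move=> Ux; exfalso; apply: nex; exists x.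
by move=> /filter_ex[t /(_ (f t))].
Qed.

Variable ro : R -> 'I_N -> C.

Variable M : ('I_N -> C) -> R -> 'S_N.
Hypothesis MP : forall v t (s' : 'S_N) (e : R),
  (forall i, normR (v i - ro t (s' i)) < e) ->
  forall i, normR (v i - ro t (M v t i)) < e.

Definition grid (k j : nat) : R := j%:R / k.+1%:R.

(** Orderings propagated from time 0, each grid time being matched with the preceding one. *)
Fixpoint grid_perm (k j : nat) : 'S_N :=
  if j is j'.+1 then M (fun i => ro (grid k j') (grid_perm k j' i)) (grid k j)
  else 1%g.

(** A time [t >= 0] is matched with the last grid time not exceeding it, so that any two times are
    linked through steps of length at most [1 / k.+1]. *)
Definition sel (k : nat) (t : R) : 'S_N :=
  let j := Num.truncn (t * k.+1%:R) in
  M (fun i => ro (grid k j) (grid_perm k j i)) t.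

Section Cluster.
Variables (t0 dl rho : R) (s' : R -> 'S_N).
Definition closeto (t : R) : Prop := 0 <= t /\ `|t0 - t| < dl.
Hypothesis s'P : forall t, closeto t -> forall i, normR (ro t (s' t i) - ro t0 i) < rho.
Hypothesis sepP : forall i j, ro t0 i <> ro t0 j -> rho * 4 <= normR (ro t0 i - ro t0 j).

Definition centered (t : R) (j c : 'I_N) : Prop := normR (ro t j - ro t0 c) < rho.

Lemma centered_ex t j : closeto t -> exists c, centered t j c.
Proof. by move=> ct; exists ((s' t)^-1%g j); have := s'P ct ((s' t)^-1%g j); rewrite permKV. Qed.

(* A jump by less than half the separation of the clusters at t0 cannot change
   cluster. *)
Lemma centered_step t t' (s : 'S_N) i c : closeto t -> closeto t' ->
  centered t (s i) c -> centered t' (M (fun i => ro t (s i)) t' i) c.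
Proof.
move=> ct ct' cen; set u := M _ _.
(* This permutation pairs each root at time [t] with a root at time [t'] of the same cluster.
   Passing through the centre costs less than [2 rho], and the greedy matching does as well. *)
have /MP/(_ i) : forall i, normR (ro t (s i) - ro t' ((s * (s' t)^-1 * s' t')%g i)) < rho *+ 2.
  move=> l; rewrite !permM; set j := (s' t)^-1%g (s l).
  rewrite (_ : s l = s' t j); last by rewrite /j permKV.
  apply: le_lt_trans (normR_distD (ro t0 j) _ _) _.
  by rewrite mulr2n ltrD// ?s'P// normR_distC s'P.
rewrite -/u => lu.
have [c' cen'] := centered_ex (u i) ct'.
(* At a multiple root several indices have the same centre, so the centres are compared and not the
   indices. *)
have [ee|ne] := pselect (ro t0 c' = ro t0 c); first by rewrite /centered -ee.
(* A jump below [2 rho] between points within [rho] of their centres puts the centres at distance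
   below [4 rho]: this is the constant of [sepP]. *)
exfalso; have := sepP ne; apply/negP; rewrite -ltNge.
apply: le_lt_trans (normR_distD (ro t' (u i)) _ _) _.
have h1 := normR_distD (ro t (s i)) (ro t' (u i)) (ro t0 c).
move: lu cen cen'; rewrite /centered normR_distC => lu cen.
rewrite normR_distC => cen'; lra.
Qed.

Lemma closeto_between a b c : closeto a -> closeto b -> a <= c <= b -> closeto c.
Proof.
move=> [a0 ha] [b0 hb] /andP[ac cb]; split; first exact: le_trans ac.
by move: ha hb; rewrite !ltr_norml => /andP[? ?] /andP[? ?]; apply/andP; split; lra.
Qed.

Lemma grid_le k j j' : (j <= j')%N -> grid k j <= grid k j'.
Proof. by move=> jj'; rewrite ler_pM2r ?invr_gt0 ?ltr0n// ler_nat. Qed.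

Lemma centered_grid k j m i c : closeto (grid k j) -> closeto (grid k (j + m)) ->
  centered (grid k j) (grid_perm k j i) c ->
  centered (grid k (j + m)) (grid_perm k (j + m) i) c.
Proof.
move=> cj; elim: m => [|m IH]; first by rewrite addn0.
rewrite addnS => cjm cen /=.
have cm : closeto (grid k (j + m)).
  by apply: closeto_between cj cjm _; rewrite !grid_le ?leq_addr.
by apply: centered_step => //; exact: IH.
Qed.

(** The cluster is fixed at the grid time just before [t]. One step leads from there to [t]; the
    following grid times and a last step lead to [t']; none of these steps changes cluster. *)
Lemma sel_centered k (t t' : R) i : 0 <= t -> t <= t' ->
  `|t0 - t| < dl / 2 -> `|t0 - t'| < dl / 2 -> k.+1%:R^-1 < dl / 2 ->
  exists c, centered t (sel k t i) c /\ centered t' (sel k t' i) c.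
Proof.
move=> t_ge0 tt' tt0 t't0 kd.
have t'_ge0 := le_trans t_ge0 tt'.
have k0 : 0 < k.+1%:R :> R by rewrite ltr0n.
(* Rounding down to the grid moves [u] by less than [1 / k.+1 < dl / 2], which is why the times are
   taken in half the radius. *)
have near_floor (u : R) : 0 <= u -> `|t0 - u| < dl / 2 ->
    closeto u /\ closeto (grid k (Num.truncn (u * k.+1%:R))).
  move=> u0 du.
  have /truncn_itv/andP[] : 0 <= u * k.+1%:R by rewrite mulr_ge0// ltW.
  rewrite -ler_pdivrMr// -ltr_pdivlMr// -[(Num.truncn _).+1%:R]natr1 mulrDl mul1r.
  rewrite -/(grid _ _) => h1 h2.
  have g0 : 0 <= grid k (Num.truncn (u * k.+1%:R)).
    by rewrite /grid divr_ge0 ?ler0n.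
  move: h1 h2 g0; set g := grid _ _ => h1 h2 g0.
  move: kd du; set h := _^-1 in h2 * => kd; rewrite ltr_norml => /andP[d1 d2]; split; split => //;
    rewrite ltr_norml; apply/andP; split; lra.
have [ct cgt] := near_floor _ t_ge0 tt0.
have [ct' cgt'] := near_floor _ t'_ge0 t't0.
have jj' : (Num.truncn (t * k.+1%:R) <= Num.truncn (t' * k.+1%:R))%N.
  by apply: le_truncn; rewrite ler_pM2r.
rewrite /sel; set j := Num.truncn (t * _) in jj' cgt *.
set j' := Num.truncn (t' * _) in jj' cgt' *.
have [c cen] := centered_ex (grid_perm k j i) cgt.
exists c; split; first exact: centered_step.
apply: centered_step => //.
by move: cgt'; rewrite -(subnKC jj') => cgt'; exact: centered_grid.
Qed.

End Cluster.
End Selection.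

(* The orderings along finer and finer grids converge along an ultrafilter,
   since at each time there are finitely many orderings. *)
Lemma continuous_root_selection (R : realType) (N : nat) (ro : R -> 'I_N -> Cplx R) :
  exists s : R -> 'S_N, forall t0 : R, 0 <= t0 ->
    (forall k, (\prod_i ('X - (ro t i)%:P))`_k
       @[t --> within [set t : R | 0 <= t] (nbhs t0)]
       --> (\prod_i ('X - (ro t0 i)%:P))`_k) ->
    forall i, ro t (s t i) @[t --> within [set t : R | 0 <= t] (nbhs t0)]
              --> ro t0 (s t0 i).
Proof.
have /choice[m mP] (vt : ('I_N -> Cplx R) * R) := best_matching vt.1 (ro vt.2).
pose M v t := m (v, t).
have MP v t (s' : 'S_N) (e : R) : (forall i, normR (v i - ro t (s' i)) < e) ->
    forall i, normR (v i - ro t (M v t i)) < e by exact: (mP (v, t)).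
have [U [UU Uoo]] := ultraFilterLemma eventually_filter.
have /choice[s sP] t : exists s, U [set k | sel ro M k t = s] by exact: ultra_finite.
exists s => t0 t0_ge0 coefs.
have [s' s'cvg] := cvg_roots_perm coefs.
move=> i; apply/cvgrPdist_lt => _ /gt0_cplx_of_real[e e0 ->].
(* The bound [e / 2] puts two points of one cluster at distance below [e]; the quarter of the
   smallest gap between distinct roots at [t0] gives the separation of the clusters. *)
pose rho := \big[Order.min/(e / 2)]_(p : 'I_N * 'I_N | ro t0 p.1 != ro t0 p.2)
  (normR (ro t0 p.1 - ro t0 p.2) / 4).
have rho0 : 0 < rho.
  apply: lt_bigmin => [|[a b] /= ab]; first by rewrite divr_gt0.
  rewrite divr_gt0// lt_def normR_ge0 andbT.
  by apply: contra ab => /eqP /normR0_eq0/eqP; rewrite subr_eq0.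
have rhoe : rho <= e / 2 by rewrite /rho bigmin_le_id.
have sepP a b : ro t0 a <> ro t0 b -> rho * 4 <= normR (ro t0 a - ro t0 b).
  move=> /eqP ab; rewrite -ler_pdivlMr//.
  exact: (@bigmin_le_cond _ _ _ _ (a, b)).
have : \forall t \near within [set t : R | 0 <= t] (nbhs t0),
    forall i, normR (ro t (s' t i) - ro t0 i) < rho.
  apply: filter_forall => j; move/cvgrPdist_lt : (s'cvg j) => /(_ (cplx_of_real rho)).
  rewrite -[X in _ < X -> _]/(cplx_of_real rho) (ltc_of_real 0) => /(_ rho0).
  by apply: filterS => t; rewrite normR_lt normR_distC.
move=> /nbhs_ballP[dl /= dl0 near_t0].
have s'P t : closeto t0 dl t -> forall i, normR (ro t (s' t i) - ro t0 i) < rho.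
  by move=> [t_ge0 tt0]; apply: near_t0 => //.
rewrite near_withinE; apply/nbhs_ballP; exists (dl / 2) => /=; first by rewrite divr_gt0.
move=> t tt0 t_ge0.
have kU : U [set k | k.+1%:R^-1 < dl / 2].
  apply: Uoo.
  have [k0 _ k0P] := near_infty_natSinv_lt (PosNum (divr_gt0 dl0 (ltr0Sn R 1))).
  by exists k0.
(* One grid, fine enough, realizes the limit ordering at both [t] and [t0]. It depends on [t], but
   the estimate drawn from it does not. *)
have [k [[/= sk sk0] kd]] := filter_ex (filterI (filterI (sP t) (sP t0)) kU).
rewrite normR_lt -sk -sk0.
have dl20 : 0 < dl / 2 by rewrite divr_gt0.
have [c [c1 c2]] : exists c, centered ro t0 rho t (sel ro M k t i) c /\
    centered ro t0 rho t0 (sel ro M k t0 i) c.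
  have [tt|tt] := leP t t0.
    by apply: (sel_centered MP s'P sepP) => //; rewrite subrr normr0.
  have tt00 : `|t0 - t0| < dl / 2 by rewrite subrr normr0.
  have [c [? ?]] := sel_centered MP s'P sepP i t0_ge0 (ltW tt) tt00 tt0 kd.
  by exists c.
apply: le_lt_trans (normR_distD (ro t0 c) _ _) _.
move: c1 c2; rewrite /centered (normR_distC (ro t _)) => c1 c2; lra.
Qed.

(** * Roots of min-plus polynomials *)

Section MinPlusRoots.
Variable R : realType.
Implicit Types (c P : seq (\bar R)) (g y : R).

(** The factorization of [mp_eval] without its constant term, as a real function. Taking [fine]
    loses nothing when no root is [-oo]. *)
Definition sum_min c y : R := \sum_(x <- c) fine (Order.min y%:E x).

Lemma sum_minE c y : all (fun x => -oo < x)%E c ->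
  (\sum_(x <- c) Order.min y%:E x)%E = (sum_min c y)%:E.
Proof.
rewrite /sum_min; elim: c => [|x c IH] /=; first by rewrite !big_nil.
move=> /andP[x0 /IH cE]; rewrite !big_cons cE EFinD fineK//.
by rewrite /Order.min; case: ifP => // /negbT; rewrite -leNgt; case: x x0.
Qed.

Lemma fine_min_fin y (x : R) : fine (Order.min y%:E x%:E) = Order.min y x.
Proof. by rewrite -EFin_min. Qed.

Lemma fine_min_pinfty y : fine (Order.min y%:E +oo%E) = y.
Proof. by rewrite /Order.min ltry. Qed.

(** Just after [g], the summand of [x] has slope 1 if [x] exceeds [g] and slope 0 otherwise. *)
Lemma sum_min_right c g : all (fun x => -oo < x)%E c ->
  exists2 d0, 0 < d0 & forall d, 0 <= d <= d0 ->
    sum_min c g + d * (count (fun x => g%:E < x)%E c)%:R <= sum_min c (g + d).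
Proof.
rewrite /sum_min; elim: c => [|x c IH] /=.
  by exists 1 => // d _; rewrite !big_nil mulr0 addr0.
move=> /andP[x0 /IH[d0 d0_gt0 d0P]].
suff [e0 e0_gt0 e0P] : exists2 e0 : R, 0 < e0 & forall d, 0 <= d <= e0 ->
    fine (Order.min g%:E x) + d * (g%:E < x)%E%:R <= fine (Order.min (g + d)%:E x).
  exists (Order.min d0 e0); first by rewrite lt_min d0_gt0.
  move=> d /andP[d_ge0]; rewrite le_min => /andP[dd0 de0].
  rewrite !big_cons natrD mulrDr addrACA lerD ?e0P ?d0P ?d_ge0//.
case: x x0 => [x||] // _.
  suff : exists2 e0 : R, 0 < e0 & forall d, 0 <= d <= e0 ->
      Order.min g x + d * (g < x)%R%:R <= Order.min (g + d) x.
    by case=> e0 ? eP; exists e0 => // d /eP; rewrite !fine_min_fin lte_fin.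
  have [gx|xg] := ltP g x.
    exists (x - g) => [|d /andP[_]]; first by rewrite subr_gt0.
    by rewrite mulr1 lerBrDl => gdx; rewrite (min_idPl gdx).
  exists 1 => // d /andP[d0' _]; rewrite mulr0 addr0.
  by rewrite le_min lexx andbT (le_trans xg)// lerDl.
exists 1 => // d _.
by rewrite !fine_min_pinfty ltry mulr1.
Qed.

(** Just before [g], the summand of a root equal to [g] also has slope 1, hence the large inequality
    in the count. *)
Lemma sum_min_left c g : all (fun x => -oo < x)%E c ->
  exists2 d0, 0 < d0 & forall d, 0 <= d <= d0 ->
    sum_min c g - d * (count (fun x => g%:E <= x)%E c)%:R <= sum_min c (g - d).
Proof.
rewrite /sum_min; elim: c => [|x c IH] /=.
  by exists 1 => // d _; rewrite !big_nil mulr0 subr0.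
move=> /andP[x0 /IH[d0 d0_gt0 d0P]].
suff [e0 e0_gt0 e0P] : exists2 e0 : R, 0 < e0 & forall d, 0 <= d <= e0 ->
    fine (Order.min g%:E x) - d * (g%:E <= x)%E%:R <= fine (Order.min (g - d)%:E x).
  exists (Order.min d0 e0); first by rewrite lt_min d0_gt0.
  move=> d /andP[d_ge0]; rewrite le_min => /andP[dd0 de0].
  rewrite !big_cons natrD mulrDr opprD addrACA lerD ?e0P ?d0P ?d_ge0//.
case: x x0 => [x||] // _.
  suff : exists2 e0 : R, 0 < e0 & forall d, 0 <= d <= e0 ->
      Order.min g x - d * (g <= x)%R%:R <= Order.min (g - d) x.
    by case=> e0 ? eP; exists e0 => // d /eP; rewrite !fine_min_fin lee_fin.
  have [gx|xg] := leP g x.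
    exists 1 => // d /andP[d_ge0 _].
    by rewrite mulr1 le_min lexx/= (le_trans _ gx)// lerBlDr lerDl.
  exists (g - x) => [|d /andP[_]]; first by rewrite subr_gt0.
  rewrite mulr0 subr0 => dgx.
  by rewrite le_min lexx andbT lerBrDl -lerBrDr.
exists 1 => // d _.
by rewrite !fine_min_pinfty leey mulr1.
Qed.

(** For large [y] the finite roots contribute constants and each infinite root contributes [y]. *)
Lemma sum_min_pinfty c : all (fun x => -oo < x)%E c ->
  exists K y0, forall y, y0 <= y -> K + y * (count_mem +oo%E c)%:R <= sum_min c y.
Proof.
rewrite /sum_min; elim: c => [|x c IH] /=.
  by exists 0, 0 => y _; rewrite big_nil mulr0 addr0.
move=> /andP[x0 /IH[K [y0 Ky0]]].
case: x x0 => [x||] // _.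
  exists (K + x), (Order.max y0 x) => y; rewrite ge_max => /andP[yy0 xy].
  rewrite big_cons fine_min_fin /= add0n addrAC addrC.
  by rewrite (min_idPr xy) lerD2l Ky0.
exists K, y0 => y yy0.
by rewrite big_cons fine_min_pinfty eqxx natrD mulrDr mulr1 addrCA lerD2l Ky0.
Qed.

Lemma mp_eval_le P l y : (l < size P)%N ->
  (mp_eval P y%:E <= nth +oo P l + (l%:R * y)%:E)%E.
Proof.
by move=> lP; rewrite /mp_eval EFinM; exact: (bigmin_le _ (Ordinal lP)).
Qed.

(** The line of the monomial of degree [l] lies above the concave function [mp_eval P] and touches
    it at [g], so its slope [l] lies between the slopes on the right and on the left of [g]. *)
Lemma mp_factors_count P c g l (v : R) : mp_factors P c -> (l < size P)%N ->
  nth +oo%E P l = v%:E -> ((v + l%:R * g)%:E <= mp_eval P g%:E)%E ->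
  (count (fun x => g%:E < x)%E c <= l <= count (fun x => g%:E <= x)%E c)%N.
Proof.
move=> [_ _ c0 PE] lP Pl.
have fP y : (nth +oo P (mp_deg P) + (sum_min c y)%:E <= (v + l%:R * y)%:E)%E.
  by rewrite -sum_minE// -PE ?ltNyr// EFinD -Pl mp_eval_le.
rewrite PE ?ltNyr// sum_minE//.
(* The leading coefficient is real: [+oo] would contradict the upper bound by the line, and [-oo]
   the contact at [g]. *)
case: (nth _ P (mp_deg P)) fP => [p||] fP fg; last 2 first.
- by have := fP g; rewrite addye// leye_eq.
- by move: fg; rewrite addNye// leeNy_eq.
move: fg; rewrite -EFinD lee_fin => fg.
have {}fP y : p + sum_min c y <= v + l%:R * y by rewrite -lee_fin EFinD.
have [d1 d1_gt0 /(_ d1)] := sum_min_right g c0.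
have [d2 d2_gt0 /(_ d2)] := sum_min_left g c0.
rewrite (ltW d1_gt0) (ltW d2_gt0) !lexx => /(_ isT) h2 /(_ isT) h1.
have := fP (g + d1); have := fP (g - d2) => f2 f1.
apply/andP; split.
  rewrite -(ler_nat R) -(ler_pM2l d1_gt0); lra.
rewrite -(ler_nat R) -(ler_pM2l d2_gt0); lra.
Qed.

(** As [y] grows, the monomial of lowest degree bounds [mp_eval P] by a line of slope [mp_val P],
    while the infinite roots force a growth at least equal to their number. *)
Lemma mp_factors_count_pinfty P c : mp_factors P c ->
  has (fun x => x != +oo%E) P -> all (fun x => -oo < x)%E P ->
  (count_mem +oo%E c <= mp_val P)%N.
Proof.
move=> [_ _ c0 PE] hP P0.
have vP : (mp_val P < size P)%N by rewrite -has_find.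
have := mem_nth +oo%E vP => /(allP P0).
have := nth_find +oo%E hP; rewrite -/(mp_val P).
case Pv : (nth _ P (mp_val P)) => [v||] //= _ _.
have fP y : (nth +oo P (mp_deg P) + (sum_min c y)%:E <= (v + (mp_val P)%:R * y)%:E)%E.
  by rewrite -sum_minE// -PE ?ltNyr// EFinD -Pv mp_eval_le.
have : (-oo < nth +oo P (mp_deg P))%E.
  have [dP|dP] := ltnP (mp_deg P) (size P); first by apply: (allP P0); exact: mem_nth.
  by rewrite nth_default.
case: (nth _ P (mp_deg P)) fP => [p||] // fP _; last first.
  by have := fP 0; rewrite addye// leye_eq.
have {}fP y : p + sum_min c y <= v + (mp_val P)%:R * y by rewrite -lee_fin EFinD.
have [K [y0 KP]] := sum_min_pinfty c0.
rewrite leqNgt; apply/negP => lt_v.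
(* Beyond this point one extra unit of slope outweighs the difference of the constants; [0 <= y]
   allows the slopes to be multiplied by [y]. *)
pose y := Order.max y0 (Order.max 0 (v - p - K + 1)).
have yy0 : y0 <= y by rewrite le_max lexx.
have y_ge0 : 0 <= y by rewrite !le_max lexx orbT.
have yv : v - p - K + 1 <= y by rewrite !le_max lexx !orbT.
have := KP _ yy0; have := fP y.
have : y * (mp_val P).+1%:R <= y * (count_mem +oo%E c)%:R by rewrite ler_wpM2l// ler_nat.
by rewrite -natr1 mulrDr mulr1 (mulrC _ y); lra.
Qed.

(** [[::]] is the default value of [xget]. *)
Lemma mp_roots_spec P : mp_roots P = [::] \/ mp_factors P (mp_roots P).
Proof.
have [[c Pc]|nP] := pselect (exists c, mp_factors P c); [right|left].
  by rewrite /mp_roots; case: xgetP => [_ -> //|/(_ c)].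
by rewrite /mp_roots; case: xgetP => // c _ Pc; case: nP; exists c.
Qed.

Lemma mp_roots_gtNy P : all (fun x => -oo < x)%E (mp_roots P).
Proof. by have [->//|[]] := mp_roots_spec P. Qed.

Lemma count_ge_split c g : count (fun x => g%:E <= x)%E c =
  (count_mem g%:E c + count (fun x => g%:E < x)%E c)%N.
Proof.
elim: c => //= x c ->; rewrite addnACA; congr (_ + _)%N.
by rewrite le_eqVlt eq_sym; case: (ltgtP x g%:E).
Qed.

End MinPlusRoots.

(** * Optimal permutations *)

(** Let [S] be a smallest non-empty stable subset. Its image is stable too, so by minimality it has
    as many elements: [f] is injective on [S] and extends by the identity to a permutation. *)
Lemma functional_cycle (n : nat) (f : 'I_n -> 'I_n) (S0 : {set 'I_n}) :
  S0 != finset.set0 -> f @: S0 \subset S0 ->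
  exists S : {set 'I_n}, [/\ S != finset.set0, S \subset S0 &
    exists p : 'S_n, forall i, p i = if i \in S then f i else i].
Proof.
move=> S0n fS0.
pose P := [pred S : {set 'I_n} | [&& S != finset.set0, S \subset S0 & f @: S \subset S]].
have PS0 : P S0 by rewrite /= S0n subxx.
case: (arg_minnP (fun S : {set 'I_n} => #|S|) PS0) => S /and3P[Sn SS0 fS] Smin.
have fSinj : {in S &, injective f}.
  apply/imset_injP; rewrite eqn_leq leq_imset_card/=; apply: Smin.
  rewrite /= imsetS// (fintype.subset_trans fS SS0) !andbT.
  by case/set0Pn : Sn => x xS; apply/set0Pn; exists (f x); exact: imset_f.
have fSS i : i \in S -> f i \in S by move=> iS; apply: (fintype.subsetP fS); exact: imset_f.
have ginj : injective (fun i => if i \in S then f i else i).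
  move=> i j; case: ifPn => iS; case: ifPn => jS //.
  - exact: fSinj.
  - by move=> ij; rewrite -ij fSS in jS.
  - by move=> ij; rewrite ij fSS in iS.
by exists S; split => //; exists (perm ginj) => i; rewrite permE.
Qed.

(* A circulation is a sum of cycles. *)
Lemma circulation_ge0 (R : realType) (n : nat) (E : rel 'I_n) (w : 'I_n -> 'I_n -> R)
    (M : 'I_n -> 'I_n -> nat) :
  reflexive E -> (forall i, w i i = 0) ->
  (forall p : 'S_n, (forall i, E i (p i)) -> 0 <= \sum_i w i (p i)) ->
  (forall i j, (0 < M i j)%N -> E i j) ->
  (forall i, \sum_j M i j = \sum_j M j i)%N ->
  0 <= \sum_i \sum_j (M i j)%:R * w i j.
Proof.
move=> Erefl w0 wP.
have [N] := ubnP (\sum_i \sum_j M i j)%N.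
elim: N M => // N IH M leN ME Mbal.
pose S0 := [set i | (0 < \sum_j M i j)%N]%SET.
have [S00|S0n] := eqVneq S0 finset.set0.
  rewrite big1// => i _; rewrite big1// => j _.
  have : i \notin S0 by rewrite S00 inE.
  by rewrite inE -leqNgt leqn0 sum_nat_eq0 => /forallP/(_ j)/eqP->; rewrite mul0r.
(* An outgoing arc is followed at each node having one. Its end has an incoming arc, hence by
   balance an outgoing one, so [S0] is stable. *)
pose f i := odflt i [pick j | (0 < M i j)%N].
have fP i : i \in S0 -> (0 < M i (f i))%N.
  rewrite inE /f; case: pickP => //= M0; rewrite big1// => j _.
  by apply/eqP; rewrite -leqn0 leqNgt M0.
have fS0 : f @: S0 \subset S0.
  apply/fintype.subsetP => _ /imsetP[i iS ->]; rewrite inE Mbal (bigD1 i)//=.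
  by rewrite ltn_addr// fP.
have [S [Sn SS0 [p pE]]] := functional_cycle S0n fS0.
pose M' i j := (M i j - ((i \in S) && (f i == j)))%N.
have ME' i j : M i j = (M' i j + ((i \in S) && (f i == j)))%N.
  rewrite /M' subnK//; case: andP => [[iS /eqP <-]|//].
  by rewrite fP// (fintype.subsetP SS0).
have rowS i : (\sum_j ((i \in S) && (f i == j)) = (i \in S))%N.
  rewrite (bigD1 (f i))//= eqxx andbT big1 ?addn0// => j; rewrite eq_sym => /negPf->.
  by rewrite andbF.
have colS i : (\sum_j ((j \in S) && (f j == i)) = (i \in S))%N.
  have -> : (\sum_j ((j \in S) && (f j == i)) = \sum_j ((j == p^-1%g i) && (i \in S)))%N.
    apply: eq_bigr => j _; congr (nat_of_bool _).
    rewrite -(inj_eq (@perm_inj _ p)) permKV pE.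
    have [jS|jS] := boolP (j \in S) => /=; last by case: eqP => // <-; rewrite (negPf jS).
    case: eqP => //= <-; apply/esym.
    rewrite -[f j](_ : p j = f j); last by rewrite pE jS.
    apply: contraT => pjS; have : p (p j) = p j by rewrite pE (negPf pjS).
    by move/perm_inj => pjj; rewrite pjj jS in pjS.
  rewrite (bigD1 (p^-1%g i))//= eqxx big1 ?addn0// => j /negPf->//.
have Mtot : (\sum_i \sum_j M i j = \sum_i \sum_j M' i j + #|S|)%N.
  have -> : #|S| = (\sum_i (i \in S))%N.
    by rewrite -sum1_card big_mkcond; apply: eq_bigr => i _; case: ifP.
  rewrite -big_split; apply: eq_bigr => i _.
  by rewrite -rowS -big_split; apply: eq_bigr.
(* Removing one copy of the arcs of [p] on [S] leaves a smaller balanced multigraph; outside [S] the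
   fixed points of [p] weigh 0. *)
rewrite (_ : \sum_i _ = \sum_i \sum_j (M' i j)%:R * w i j + \sum_i w i (p i)).
  apply: addr_ge0.
    apply: IH.
    - by move: leN; rewrite Mtot -card_gt0 in Sn *; move: Sn; lia.
    - by move=> i j M'0; apply: ME; rewrite ME' ltn_addr.
    - move=> i; apply/eqP; rewrite -(eqn_add2r (i \in S)) -{1}rowS -colS -!big_split/=.
      apply/eqP; move: (Mbal i); under eq_bigr do rewrite ME'.
      by under [in RHS]eq_bigr do rewrite ME'.
  apply: wP => i; rewrite pE; case: ifPn => // iS.
  by apply: ME; rewrite fP// (fintype.subsetP SS0).
rewrite -big_split/=; apply: eq_bigr => i _.
under eq_bigr do rewrite ME' natrD mulrDl.
rewrite big_split/=; congr (_ + _); rewrite (bigD1 (f i))//= eqxx andbT.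
rewrite big1 => [|j]; last by rewrite eq_sym => /negPf->; rewrite andbF mul0r.
by rewrite addr0 pE; case: ifP; rewrite ?mul1r// mul0r w0.
Qed.

Section Optimal.
Variables (R : realType) (n : nat) (B : 'M[\bar R]_n).
Hypothesis per_fin : mp_per B \is a fin_num.
Implicit Type s : 'S_n.

Lemma mp_per_le s : (mp_per B <= mp_weight B s)%E.
Proof. exact: bigmin_le. Qed.

Lemma mp_per_attained : exists s, mp_weight B s = mp_per B.
Proof.
have [||s _ sE] := @eq_bigmin _ _ _ +oo%E (1%g : 'S_n) xpredT (mp_weight B).
- by [].
- by move=> *; exact: leey.
by exists s; rewrite /mp_per sE.
Qed.

Lemma mp_weight_fine s : (forall i, B i (s i) \is a fin_num) ->
  mp_weight B s = (\sum_i fine (B i (s i)))%:E.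
Proof. by move=> Bfin; rewrite /mp_weight -EFin_sum_fine. Qed.

Lemma mp_weight_fin s : mp_weight B s = mp_per B -> forall i, B i (s i) \is a fin_num.
Proof.
by move=> sE i; move: per_fin; rewrite -sE => /sum_fin_numP; apply; rewrite ?mem_index_enum.
Qed.

Lemma Opt_weight s : mp_weight B s = mp_per B -> forall i, Opt B i (s i).
Proof. by move=> sE i; apply/existsP; exists s; rewrite eqxx sE eqxx. Qed.

Lemma Opt_fin i j : Opt B i j -> B i j \is a fin_num.
Proof. by case/existsP => s /andP[/eqP-> /eqP/mp_weight_fin]. Qed.

(* If s uses only arcs of optimal permutations r_k, the multigraph of the r_k
   minus the graph of s is a sum of cycles, of non-negative relative weight. *)
Lemma Opt_optimal s : (forall i, Opt B i (s i)) -> mp_weight B s = mp_per B.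
Proof.
move=> sO; have [t tE] := mp_per_attained.
pose b i j := fine (B i j).
have weightE (u : 'S_n) : (forall i, Opt B i (u i)) -> mp_weight B u = (\sum_i b i (u i))%:E.
  by move=> uO; apply: mp_weight_fine => i; exact: Opt_fin.
have tO := Opt_weight tE.
have /choice[r rP] k : exists r : 'S_n, s k = r k /\ mp_weight B r = mp_per B.
  by case/existsP: (sO k) => r /andP[/eqP ? /eqP ?]; exists r.
(* Relabelling the columns by [t] turns the optimal permutation [t] into the identity, so that loops
   have relative weight 0 and a permutation [p] stands for [p * t]. *)
pose E i j := Opt B i (t j).
pose w i j := b i (t j) - b i (t i).
pose M i j := ((\sum_k (r k i == t j)) - (s i == t j))%N.
have leM i j : ((s i == t j) <= \sum_k (r k i == t j))%N.
  case: eqP => // si; rewrite (bigD1 i)//= -(proj1 (rP i)) si eqxx.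
  exact: leq_addr.
have sumw (u : 'S_n) : (forall i, Opt B i (u i)) ->
    \sum_i \sum_j (u i == t j)%:R * w i j = \sum_i b i (u i) - \sum_i b i (t i).
  move=> uO; rewrite -sumrB; apply: eq_bigr => i _.
  rewrite (bigD1 (t^-1%g (u i)))//= /w permKV eqxx mul1r big1 ?addr0// => j.
  by rewrite -(inj_eq (@perm_inj _ t)) permKV eq_sym => /negPf->; rewrite mul0r.
have rO k : forall i, Opt B i (r k i) by apply: Opt_weight; exact: (proj2 (rP k)).
have sumr k : \sum_i b i (r k i) = \sum_i b i (t i).
  by apply: EFin_inj; rewrite -!weightE// tE; exact: (proj2 (rP k)).
have row (u : 'S_n) i : (\sum_j (u i == t j) = 1)%N.
  rewrite (bigD1 (t^-1%g (u i)))//= permKV eqxx big1// => j.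
  by rewrite -(inj_eq (@perm_inj _ t)) permKV eq_sym => /negPf->.
have col (u : 'S_n) i : (\sum_j (u j == t i) = 1)%N.
  rewrite (bigD1 (u^-1%g (t i)))//= permKV eqxx big1// => j.
  by rewrite -(inj_eq (@perm_inj _ u)) permKV => /negPf->.
have := @circulation_ge0 R n E w M.
(* Each [r k] has relative weight 0, so only the subtracted graph of [s] remains. The truncated
   subtraction in [M] is exact because the arc of [s] out of [i] belongs to [r i]. *)
have -> : \sum_i \sum_j (M i j)%:R * w i j = \sum_i b i (t i) - \sum_i b i (s i).
  transitivity (\sum_i \sum_j \sum_k (r k i == t j)%:R * w i j -
                \sum_i \sum_j (s i == t j)%:R * w i j).
    rewrite -sumrB; apply: eq_bigr => i _; rewrite -sumrB; apply: eq_bigr => j _.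
    by rewrite /M natrB// mulrBl natr_sum -mulr_suml.
  rewrite sumw// -[X in X - _](_ : 0 = _) ?sub0r ?opprB//.
  rewrite (eq_bigr (fun i => \sum_k \sum_j (r k i == t j)%:R * w i j)); last first.
    by move=> i _; rewrite exchange_big.
  by rewrite exchange_big big1// => k _; rewrite sumw// sumr subrr.
move=> /(_ _ _ _ _ _)/wrap[//|i|p pO|i j|i|]; rewrite /w ?subrr//.
- rewrite sumrB subr_ge0.
  have : (mp_per B <= mp_weight B (p * t)%g)%E by exact: mp_per_le.
  rewrite -tE !weightE// => [|i]; last by rewrite permM; exact: pO.
  by rewrite lee_fin; under [leRHS]eq_bigr do rewrite permM.
- rewrite /M => M0; have [k] : exists k, r k i == t j.
    apply/existsP; apply: contraTT M0; rewrite negb_exists => /forallP rk.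
    by rewrite big1 ?sub0n// => k _; rewrite (negPf (rk k)).
  by move=> /eqP rk; rewrite /E -rk; exact: rO.
- apply/eqP; rewrite -(eqn_add2r 1) -{1}(row s i) -{1}(col s i) -!big_split/=.
  under eq_bigr do rewrite /M subnK//.
  under [X in _ == X]eq_bigr do rewrite /M subnK//.
  rewrite exchange_big [X in _ == X]exchange_big/=; apply/eqP.
  by apply: eq_bigr => k _; rewrite row col.
rewrite subr_ge0 => st; apply/eqP; rewrite eq_le mp_per_le andbT.
by rewrite -tE !weightE// lee_fin.
Qed.

(** Complementary slackness: the potentials sum to the permanent along any permutation, so an
    optimal one has non-negative reduced costs of sum 0. *)
Lemma Sat_weight U V s : hungarian_pair B U V ->
  (forall i, Sat B U V i (s i)) <-> mp_weight B s = mp_per B.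
Proof.
move=> [UVle UVper].
have sumUV : \sum_i (U 0 i + V 0 (s i)) = \sum_i U 0 i + \sum_i V 0 i.
  by rewrite big_split/= [X in _ = _ + X](reindex_inj (@perm_inj _ s)).
split=> [sS|sE i].
  rewrite -UVper -sumUV -sumEFin; apply: eq_bigr => i _; exact/eqP/sS.
have sfin := mp_weight_fin sE.
have h j : 0 <= fine (B j (s j)) - (U 0 j + V 0 (s j)).
  by rewrite subr_ge0 -lee_fin fineK.
have : \sum_j (fine (B j (s j)) - (U 0 j + V 0 (s j))) = 0.
  rewrite sumrB sumUV; apply/eqP; rewrite subr_eq0; apply/eqP/EFin_inj.
  by rewrite UVper -mp_weight_fine.
move/eqP; rewrite psumr_eq0// => /allP/(_ i (mem_index_enum _)).
by rewrite subr_eq0 => /eqP iE; rewrite /Sat -iE fineK.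
Qed.

(** Through this equivalence the two choices of [G] are treated together from here on. *)
Lemma optimal_graph (G : rel 'I_n) s :
  (G =2 Opt B \/ exists U V, hungarian_pair B U V /\ G =2 Sat B U V) ->
  (forall i, G i (s i)) <-> mp_weight B s = mp_per B.
Proof.
move=> [GE|[U [V [UV GE]]]].
  split=> [Gs|/Opt_weight Os i]; last by rewrite GE.
  by apply: Opt_optimal => i; rewrite -GE.
rewrite -(Sat_weight _ UV); split=> Gs i; last by rewrite GE.
by rewrite -GE.
Qed.

End Optimal.

(** * Expansions of the characteristic polynomials *)

Section CharacteristicPolynomial.
Variables (R : realType) (n d : nat).
Local Notation C := (Cplx R).

Lemma matpolyE (a : 'I_d.+1 -> 'M[C]_n) i j :
  matpoly a i j = \sum_(k < d.+1) 'X^k * (a k i j)%:P.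
Proof. by rewrite /matpoly summxE; apply: eq_bigr => k _; rewrite !mxE. Qed.

(** Leibniz formula, each product being expanded over the degree [k i] chosen in row [i]. *)
Lemma coef_charp (a : 'I_d.+1 -> 'M[C]_n) (l : nat) : (charp a)`_l =
  \sum_(s : 'S_n) \sum_(k : {ffun 'I_n -> 'I_d.+1} | (\sum_i k i)%N == l)
    (-1) ^+ s * \prod_i a (k i) i (s i).
Proof.
rewrite /charp /determinant coef_sum; apply: eq_bigr => s _.
under eq_bigr do rewrite matpolyE.
rewrite bigA_distr_bigA/= -signr_odd -polyC1 -polyCN -polyC_exp coefCM coef_sum.
rewrite big_distrr/= [RHS]big_mkcond/= signr_odd; apply: eq_bigr => k _.
rewrite big_split/= -expr_sum -(big_morph _ (rmorphM _) (rmorph1 _)) coefMC coefXn.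
by rewrite eq_sym; case: eqP => _; rewrite ?mul1r ?mul0r ?mulr0.
Qed.

Lemma sum_ffun_le (k : {ffun 'I_n -> 'I_d.+1}) : (\sum_i k i <= n * d)%N.
Proof.
have -> : (n * d = \sum_(i < n) d)%N by rewrite sum_nat_const card_ord.
apply: leq_sum => i _.
by rewrite -ltnS ltn_ord.
Qed.

Lemma size_charp (a : 'I_d.+1 -> 'M[C]_n) : (size (charp a) <= (n * d).+1)%N.
Proof.
apply/leq_sizeP => l ndl; rewrite coef_charp big1// => s _; rewrite big1// => k /eqP kl.
by have := sum_ffun_le k; rewrite kl leqNgt ndl.
Qed.

Variable A : 'I_d.+1 -> 'M[\bar R]_n.
Hypothesis A_gtNy : forall k i j, A k i j != -oo%E.
Implicit Types (s : 'S_n) (k : {ffun 'I_n -> 'I_d.+1}) (g : R).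
Local Open Scope ereal_scope.

Lemma size_mp_charp : size (mp_charp A) = (n * d).+1.
Proof. by rewrite size_mkseq. Qed.

Lemma mp_charp_le s k :
  nth +oo (mp_charp A) (\sum_i k i)%N <= \sum_i A (k i) i (s i).
Proof.
rewrite nth_mkseq ?ltnS ?sum_ffun_le//.
by apply: (bigmin_inf s) => //; exact: (bigmin_inf k).
Qed.

Lemma mp_charp_ge l x :
  (forall s k, (\sum_i k i)%N = l -> x <= \sum_i A (k i) i (s i)) ->
  x <= nth +oo (mp_charp A) l.
Proof.
move=> xP; have [ll|ll] := ltnP l (n * d).+1; last first.
  by rewrite nth_default ?leey// size_mp_charp.
rewrite nth_mkseq//; apply: le_bigmin => [|s _]; first exact: leey.
by apply: le_bigmin => [|k /eqP kl]; [exact: leey|exact: xP].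
Qed.

Lemma sum_entries_gtNy s k : \sum_i A (k i) i (s i) != -oo.
Proof. by apply/negP => /eqP/esum_eqNyP[i [_ _ /eqP]]; apply/negP. Qed.

Lemma mp_charp_gtNy : all (fun x => -oo < x) (mp_charp A).
Proof.
apply/allP => x /(nthP +oo)[l ll <-]; rewrite nth_mkseq -?size_mp_charp//.
apply: lt_bigmin => // s _; apply: lt_bigmin => // k _.
by rewrite ltNye sum_entries_gtNy.
Qed.

(** The exponent of the term [(s, k)] of the determinant after [Y] is replaced by [e^g Y]. *)
Definition hat_weight g s k : \bar R :=
  \sum_i (A (k i) i (s i) + ((k i)%:R * g)%:E).

Lemma hat_weightE g s k :
  hat_weight g s k = \sum_i A (k i) i (s i) + ((\sum_i k i)%N%:R * g)%:E.
Proof.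
by rewrite /hat_weight big_split/= sumEFin -mulr_suml natr_sum.
Qed.

Lemma mp_hat_le g (k : 'I_d.+1) i j : mp_hat A g i j <= A k i j + (k%:R * g)%:E.
Proof. by rewrite mxE; exact: bigmin_le. Qed.

Lemma mp_per_hat_le g s k : mp_per (mp_hat A g) <= hat_weight g s k.
Proof.
apply: le_trans (mp_per_le _ s) _; apply: lee_sum => i _; exact: mp_hat_le.
Qed.

Lemma mp_per_hat_le_eval g : mp_per (mp_hat A g) <= mp_eval (mp_charp A) g%:E.
Proof.
rewrite /mp_eval; apply: le_bigmin => [|l _]; first exact: leey.
rewrite -EFinM -leeBlDr//; apply: mp_charp_ge => s k kl.
by rewrite leeBlDr// -kl -hat_weightE mp_per_hat_le.
Qed.

End CharacteristicPolynomial.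

Lemma eq_sum_fin (R : realDomainType) (I : finType) (f g : I -> \bar R) :
  (forall i, f i <= g i)%E -> (\sum_i f i \is a fin_num)%E ->
  (\sum_i g i = \sum_i f i)%E -> forall i, g i = f i.
Proof.
move=> fg ffin gf i.
have gfin : (\sum_i g i \is a fin_num)%E by rewrite gf.
move/sum_fin_numP: ffin => ffin; move/sum_fin_numP : gfin => gfin.
have {}ffin j : f j \is a fin_num by apply: ffin; rewrite ?mem_index_enum.
have {}gfin j : g j \is a fin_num by apply: gfin; rewrite ?mem_index_enum.
have : \sum_i (fine (g i) - fine (f i)) = 0.
  apply/eqP; rewrite sumrB subr_eq0; apply/eqP/EFin_inj.
  by rewrite !EFin_sum_fine.
move/eqP; rewrite psumr_eq0 => [/allP/(_ i (mem_index_enum _))|j _]; last first.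
  by rewrite subr_ge0 fine_le.
by rewrite subr_eq0 => /eqP gfi; rewrite -[LHS]fineK// gfi fineK.
Qed.

Section Dominant.
Variables (R : realType) (n d : nat) (A : 'I_d.+1 -> 'M[\bar R]_n) (g : R).
Variable G : rel 'I_n.
Hypothesis per_fin : mp_per (mp_hat A g) \is a fin_num.
Hypothesis GP : G =2 Opt (mp_hat A g) \/
  exists U V, hungarian_pair (mp_hat A g) U V /\ G =2 Sat (mp_hat A g) U V.

(** The permanent is at most the weight of [s], itself at most the weight of [(s, k)]. Equality in
    the first place puts the arcs in [G]; in the second, each degree [k i] attains the minimum
    defining the entry of [mp_hat]. *)
Lemma hat_weight_eq (s : 'S_n) (k : {ffun 'I_n -> 'I_d.+1}) :
  hat_weight A g s k = mp_per (mp_hat A g) <->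
  forall i, mp_graph A g (k i) i (s i) && G i (s i).
Proof.
split=> [wE|kG].
  have sE : mp_weight (mp_hat A g) s = mp_per (mp_hat A g).
    apply/eqP; rewrite eq_le mp_per_le andbT -wE.
    by apply: lee_sum => i _; exact: mp_hat_le.
  move=> i; rewrite (proj2 (optimal_graph per_fin s GP) sE) andbT.
  have hfin := mp_weight_fin per_fin sE.
  rewrite /mp_graph addeC; apply/andP; split; last first.
    by have := hfin i; rewrite fin_numE => /andP[].
  apply/eqP; apply: (eq_sum_fin (f := fun i => mp_hat A g i (s i))
    (g := fun i => A (k i) i (s i) + ((k i)%:R * g)%:E)%E) => [j||].
  - exact: mp_hat_le.
  - by rewrite -[X in X \is a _]/(mp_weight _ s) sE.
  - by rewrite -[LHS]/(hat_weight A g s k) wE -sE.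
have Gs i : G i (s i) by case/andP: (kG i).
rewrite -(proj1 (optimal_graph per_fin s GP) Gs); apply: eq_bigr => i _.
by case/andP: (kG i) => /andP[/eqP <- _] _; rewrite addeC.
Qed.

End Dominant.

(** * Asymptotics of the rescaled characteristic polynomial *)

Section RealPowers.
Variable R : realType.
Local Notation C := (Cplx R).

Lemma normr_cplx_of_real (x : R) : `|cplx_of_real x| = cplx_of_real `|x|.
Proof. by rewrite /cplx_of_real normc_def/= expr0n/= addr0 sqrtr_sqr. Qed.

Lemma cplx_of_realM (x y : R) : cplx_of_real (x * y) = cplx_of_real x * cplx_of_real y.
Proof. exact: rmorphM. Qed.

Lemma cvg_cplx_of_real (T : Type) (F : set_system T) {FF : Filter F} (f : T -> R) (l : R) :
  f x @[x --> F] --> l -> cplx_of_real (f x) @[x --> F] --> cplx_of_real l.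
Proof.
move=> /cvgrPdist_lt fl; apply/cvgrPdist_lt => _ /gt0_cplx_of_real[e e0 ->].
have := fl _ e0; apply: filterS => x.
by rewrite -ltc_of_real -normr_cplx_of_real /cplx_of_real rmorphB.
Qed.

Lemma powR_continuous_at (x t : R) : 0 < t -> a `^ x @[a --> t] --> t `^ x.
Proof.
move=> t0.
have : expR (x * ln a) @[a --> t] --> expR (x * ln t).
  apply: continuous_cvg; first exact: continuous_expR.
  by apply: cvgMr => //; exact: continuous_ln.
rewrite {2}/powR gt_eqF//; apply: cvg_trans; apply: near_eq_cvg.
near=> a; rewrite /powR gt_eqF//.
by near: a; exact: lt_nbhsr.
Unshelve. all: by end_near. Qed.

Lemma powR_add_gt0 (e x y : R) : 0 < e -> e `^ (x + y) = e `^ x * e `^ y.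
Proof. by move=> e0; rewrite powRD// (gt_eqF e0) implybT. Qed.

Lemma powR_sum (I : Type) (r : seq I) (e : R) (x : I -> R) : 0 < e ->
  e `^ (\sum_(i <- r) x i) = \prod_(i <- r) e `^ x i.
Proof.
move=> e0; elim: r => [|i r IH]; first by rewrite !big_nil powRr0.
by rewrite !big_cons powR_add_gt0// IH.
Qed.

Lemma cplx_powR_neq0 (t x : R) : 0 < t -> cplx_of_real (t `^ x) != 0.
Proof.
move=> t0; rewrite -normr_gt0 normr_cplx_of_real (ltc_of_real 0).
by rewrite normr_gt0 gt_eqF// powR_gt0.
Qed.

Lemma near_right_gt0 : \forall e \near (0 : R)^'+, 0 < e.
Proof. exact: nbhs_right_gt. Qed.

Lemma near_rightP (P : R -> Prop) : (\forall e \near 0^'+, P e) ->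
  exists2 e1, 0 < e1 & forall e, 0 < e < e1 -> P e.
Proof.
move=> /nbhs_ballP[e1 /= e1_gt0 e1P]; exists e1 => // e /andP[e0 ee1].
by apply: e1P => //=; rewrite /ball/= sub0r normrN gtr0_norm.
Qed.

End RealPowers.

Section Asymptotics.
Variables (R : realType) (n d : nat).
Local Notation C := (Cplx R).
Variables (F : 'I_d.+1 -> R -> 'M[C]_n) (a : 'I_d.+1 -> 'M[C]_n).
Variable A : 'I_d.+1 -> 'M[\bar R]_n.
Hypothesis hA : forall k i j, A k i j != -oo%E.
Hypothesis hFa : forall k i j, simeq (fun e => F k e i j) (a k i j) (A k i j).
Implicit Type s : 'S_n.

Lemma prod_entries_near0 s (k : {ffun 'I_n -> 'I_d.+1}) : (exists i, A (k i) i (s i) = +oo%E) ->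
  \forall e \near 0^'+, \prod_i F (k i) e i (s i) = 0.
Proof.
move=> [i Ai]; have := hFa (k i) i (s i); rewrite Ai /simeq.
by apply: filterS => e Fe0; rewrite (bigD1 i)//= Fe0 mul0r.
Qed.

(** Every term of such a coefficient has a factor of exponent [+oo], which vanishes near 0. There
    are finitely many terms, hence a common neighbourhood. *)
Lemma coef_charp_near0 : \forall e \near 0^'+, forall l,
  nth +oo%E (mp_charp A) l = +oo%E -> (charp (fun k => F k e))`_l = 0.
Proof.
have : \forall e \near (0:R)^'+, forall (sk : 'S_n * {ffun 'I_n -> 'I_d.+1}),
    (exists i, A (sk.2 i) i (sk.1 i) = +oo%E) -> \prod_i F (sk.2 i) e i (sk.1 i) = 0.
  apply: filter_forall => sk.
  have [ex|nex] := pselect (exists i, A (sk.2 i) i (sk.1 i) = +oo%E).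
    by have := prod_entries_near0 ex; apply: filterS.
  by apply: nearW => e ex.
apply: filterS => e prod0 l PAl.
rewrite coef_charp big1// => s _; rewrite big1// => k /eqP kl.
rewrite (prod0 (s, k)) ?mulr0//=.
have : (\sum_i A (k i) i (s i) = +oo)%E.
  by apply/eqP; rewrite -leye_eq -PAl -kl mp_charp_le.
by move=> /esum_eqyP[//|i [_ _ ?]]; exists i.
Qed.

Lemma mp_charp_regular : germ_regular F -> mp_regular A.
Proof.
move=> Freg; apply: contrapT => nreg; apply: Freg.
have := coef_charp_near0; apply: filterS => e vanish.
apply/polyP => l; rewrite coef0 vanish//.
have [ll|ll] := ltnP l (size (mp_charp A)); last by rewrite nth_default.
apply/eqP; apply: contrapT => /negP lP; apply: nreg.
by apply/hasP; exists (nth +oo%E (mp_charp A) l) => //; exact: mem_nth.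
Qed.

Hypothesis hF : forall k i j, in_germ_ring (fun e => F k e i j).

Lemma entries_continuous : \forall t \near 0^'+, forall k i j,
  F k e i j @[e --> t] --> F k t i j.
Proof.
apply: filter_forall => k; apply: filter_forall => i; apply: filter_forall => j.
have [e0 [K [e0_gt0 _ Fcont _]]] := hF k i j.
near=> t; apply: Fcont; rewrite in_itv/=; apply/andP; split; near: t.
  exact: nbhs_right_gt.
exact: nbhs_right_lt.
Unshelve. all: by end_near. Qed.

Lemma coef_charp_continuous : \forall t \near 0^'+, forall l,
  (charp (fun k => F k e))`_l @[e --> t] --> (charp (fun k => F k t))`_l.
Proof.
have := entries_continuous; apply: filterS => t Ft l.
rewrite coef_charp (_ : (fun e => _) = (fun e => \sum_(s : 'S_n)
    \sum_(k : {ffun 'I_n -> 'I_d.+1} | (\sum_i k i)%N == l)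
    (-1) ^+ s * \prod_i F (k i) e i (s i))); last by apply/funext => e; exact: coef_charp.
apply: (@cvg_sumr _ _ (nbhs t)) => s _; apply: (@cvg_sumr _ _ (nbhs t)) => k _.
apply: (@cvgM _ _ (nbhs t)); first exact: cvg_cst.
by apply: (@cvg_prodr _ _ (nbhs t)) => i _; exact: Ft.
Qed.

Variables (g : R) (G : rel 'I_n).
Hypothesis per_fin : mp_per (mp_hat A g) \is a fin_num.
Hypothesis GP : G =2 Opt (mp_hat A g) \/
  exists U V, hungarian_pair (mp_hat A g) U V /\ G =2 Sat (mp_hat A g) U V.

(** The coefficients of the polynomial [ag] of the theorem. *)
Definition dominant_coef (k : 'I_d.+1) : 'M[C]_n :=
  mx_restrict (a k) (fun i j => mp_graph A g k i j && G i j).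

(* Exponent of the factor multiplying the coefficient of degree l when Y is
   rescaled to e^g Y and the polynomial is divided by e^per. *)
Definition scaling_exp (l : nat) : R := l%:R * g - fine (mp_per (mp_hat A g)).

Lemma dominant_prod s (k : {ffun 'I_n -> 'I_d.+1}) : \prod_i dominant_coef (k i) i (s i) =
  if hat_weight A g s k == mp_per (mp_hat A g) then \prod_i a (k i) i (s i) else 0.
Proof.
case: eqP => [/hat_weight_eq-/(_ G per_fin GP) kG|kG].
  by apply: eq_bigr => i _; rewrite mxE kG.
have [i iP] : exists i, ~~ (mp_graph A g (k i) i (s i) && G i (s i)).
  apply: contrapT => nex; apply: kG; apply: (proj2 (hat_weight_eq per_fin GP s k)) => i.
  by apply: contrapT => /negP ?; apply: nex; exists i.
by rewrite (bigD1 i)//= mxE (negPf iP) mul0r.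
Qed.

(** For finite exponents, the left side is the product of the normalized entries times [e] to the
    power [w] minus the permanent. This power is non-negative, so the factor tends to 1 or 0
    according to whether it is zero. *)
Lemma scaled_prod_cvg s (k : {ffun 'I_n -> 'I_d.+1}) :
  cplx_of_real (e `^ scaling_exp (\sum_i k i)) * \prod_i F (k i) e i (s i)
    @[e --> 0^'+] --> \prod_i dominant_coef (k i) i (s i).
Proof.
rewrite dominant_prod.
(* With an infinite exponent the product vanishes near 0, and the weight [+oo] differs from the
   finite permanent. *)
have [/existsP[i /eqP Ai]|] := boolP [exists i, A (k i) i (s i) == +oo%E].
  have -> : hat_weight A g s k = +oo%E.
    apply/esum_eqyP => [j _|]; first by rewrite -ltNye lteNye; case: (A _ _ _) (hA (k j) j (s j)).
    by exists i; rewrite Ai mem_index_enum.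
  rewrite eq_sym; have := per_fin; rewrite fin_numE => /andP[_ /negPf->].
  apply: (@cvg_trans _ ((0 : C) @[_ --> (0 : R)^'+])); last exact: cvg_cst.
  apply: near_eq_cvg.
  by have := prod_entries_near0 (ex_intro _ i Ai); apply: filterS => e ->; rewrite mulr0.
rewrite negb_exists => /forallP Afin.
pose r i := fine (A (k i) i (s i)).
have AE i : A (k i) i (s i) = (r i)%:E.
  by rewrite fineK// fin_numE hA Afin.
pose w := \sum_i r i + (\sum_i k i)%N%:R * g.
have wE : hat_weight A g s k = w%:E.
  by rewrite hat_weightE (eq_bigr _ (fun i _ => AE i)) sumEFin.
have wp : fine (mp_per (mp_hat A g)) <= w.
  by rewrite -lee_fin fineK// -wE mp_per_hat_le.
have prodcvg : \prod_i (cplx_of_real (e `^ (- r i)) * F (k i) e i (s i))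
    @[e --> 0^'+] --> \prod_i a (k i) i (s i).
  by apply: cvg_prodr => i _; have := hFa (k i) i (s i); rewrite AE.
have : cplx_of_real (e `^ (w - fine (mp_per (mp_hat A g)))) *
    \prod_i (cplx_of_real (e `^ (- r i)) * F (k i) e i (s i)) @[e --> 0^'+] -->
    if hat_weight A g s k == mp_per (mp_hat A g) then \prod_i a (k i) i (s i) else 0.
  have -> : (hat_weight A g s k == mp_per (mp_hat A g)) = (w == fine (mp_per (mp_hat A g))).
    by rewrite wE -{1}(fineK per_fin).
  case: eqP => [->|wne].
    rewrite -[X in _ --> X]mul1r; apply: cvgM prodcvg.
    rewrite subrr (_ : (fun e => _) = cst 1); first exact: cvg_cst.
    by apply/funext => e; rewrite powRr0.
  rewrite -[X in _ --> X](mul0r (\prod_i a (k i) i (s i))); apply: cvgM prodcvg.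
  apply: (@cvg_cplx_of_real _ _ _ _ _ 0); apply: powR_cvg0.
  by rewrite subr_gt0 lt_neqAle wp andbT eq_sym; exact/eqP.
apply: cvg_trans; apply: near_eq_cvg; near=> e.
have e0 : 0 < e by near: e; exact: nbhs_right_gt.
rewrite big_split/= mulrA; congr (_ * _).
rewrite -(big_morph _ (@cplx_of_realM R) (erefl (cplx_of_real 1))).
rewrite -powR_sum// -cplx_of_realM -powR_add_gt0//; congr (cplx_of_real (_ `^ _)).
by rewrite sumrN /scaling_exp /w; ring.
Unshelve. all: by end_near. Qed.

Lemma scaled_coef_cvg l :
  cplx_of_real (e `^ scaling_exp l) * (charp (fun k => F k e))`_l
    @[e --> 0^'+] --> (charp dominant_coef)`_l.
Proof.
rewrite coef_charp (_ : (fun e => _) = (fun e => \sum_(s : 'S_n)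
    \sum_(k : {ffun 'I_n -> 'I_d.+1} | (\sum_i k i)%N == l)
    (-1) ^+ s * (cplx_of_real (e `^ scaling_exp (\sum_i k i)) *
      \prod_i F (k i) e i (s i)))); last first.
  apply/funext => e; rewrite coef_charp big_distrr/=; apply: eq_bigr => s _.
  rewrite big_distrr/=; apply: eq_bigr => k /eqP->.
  by rewrite mulrCA.
apply: cvg_sumr => s _; apply: cvg_sumr => k _; apply: cvgM; first exact: cvg_cst.
exact: scaled_prod_cvg.
Qed.

End Asymptotics.

(** * Roots on the projective line *)

Section PolynomialRoots.
Variable R : realType.
Local Notation C := (Cplx R).
Implicit Types (p q : {poly C}) (zs : seq C) (es : seq (option C)).

Lemma proots_factor p : p = lead_coef p *: \prod_(z <- proots p) ('X - z%:P).
Proof. exact: (svalP (closed_field_poly_normal p)). Qed.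

Lemma size_proots p : p != 0 -> size (proots p) = poly_deg p.
Proof.
move=> p0; rewrite /poly_deg {2}(proots_factor p) size_scale ?lead_coef_eq0//.
by rewrite size_prod_XsubC.
Qed.

Lemma prod_XsubC_X zs : exists2 u : {poly C}, u`_0 != 0 &
  \prod_(z <- zs) ('X - z%:P) = 'X^(count_mem 0 zs) * u.
Proof.
elim: zs => [|z zs [u u0 IH]]; first by exists 1; rewrite ?big_nil ?mul1r ?coef1 ?oner_eq0.
rewrite big_cons IH /=; have [->|z0] := eqVneq z 0.
  by exists u => //; rewrite subr0 add1n exprS mulrA.
exists (('X - z%:P) * u); last by rewrite mulrCA.
by rewrite mulrBl coefB coefXM coefCM sub0r oppr_eq0 mulf_neq0.
Qed.

Lemma poly_val_proots p : p != 0 -> poly_val p = count_mem 0 (proots p).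
Proof.
move=> p0; have [u u0 uE] := prod_XsubC_X (proots p).
have lp0 : lead_coef p != 0 by rewrite lead_coef_eq0.
have pE l : p`_l = if (l < count_mem (0 : C)%R (proots p))%N then 0
    else lead_coef p * u`_(l - count_mem (0 : C)%R (proots p)).
  rewrite {1}(proots_factor p) uE coefZ coefXnM; case: ifP => // _; exact: mulr0.
set m := count_mem 0 _ in pE *.
have pm : p`_m != 0 by rewrite pE ltnn subnn mulf_neq0.
have hp : has (fun c => c != 0) p.
  apply/hasP; exists p`_m => //; apply: mem_nth; rewrite ltnNge; apply: contra pm => ?.
  by rewrite nth_default.
apply/eqP; rewrite eqn_leq; apply/andP; split; rewrite leqNgt; apply/negP.
  by move=> /(before_find 0); rewrite pm.
by move=> lt; have := nth_find 0 hp; rewrite -/(poly_val p) pE lt eqxx.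
Qed.

Lemma size_nonzero_proots p : p != 0 ->
  (size [seq z <- proots p | z != 0%R] + poly_val p)%N = poly_deg p.
Proof.
move=> p0; rewrite poly_val_proots// -size_proots// size_filter addnC.
exact: count_predC.
Qed.

(** In characteristic 0, [p] cannot vanish at [size p] distinct integers. *)
Lemma ex_nonroot p : p != 0 -> exists w, p.[w] != 0.
Proof.
move=> p0; apply: contrapT => nex.
pose rs := [seq (k%:R : C) | k <- iota 0 (size p)].
have : (size rs < size p)%N.
  apply: max_poly_roots => //.
    by apply/allP => z _; apply: contrapT => /negP zr; apply: nex; exists z.
  by rewrite map_inj_uniq ?iota_uniq// => k l /eqP; rewrite eqr_nat => /eqP.
by rewrite size_map size_iota ltnn.
Qed.

(* es lists the roots of p on the projective line, p being seen as a form of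
   degree N. *)
Definition projective_roots (N : nat) p es : Prop :=
  exists c zs, [/\ c != 0, p = c *: \prod_(z <- zs) ('X - z%:P), (size zs <= N)%N &
    perm_eq es (map Some zs ++ nseq (N - size zs) None)].

Lemma size_projective_roots N p es : projective_roots N p es -> size es = N.
Proof.
by move=> [c [zs [_ _ sz /perm_size->]]]; rewrite size_cat size_map size_nseq subnKC.
Qed.

Lemma projective_roots_neq N p es w : projective_roots N p es -> p.[w] != 0 ->
  Some w \notin es.
Proof.
move=> [c [zs [_ pE _ /perm_mem->]]]; apply: contra.
rewrite mem_cat mem_nseq andbF orbF mem_map => [|? ? []//].
move=> wzs; rewrite pE hornerZ; apply/eqP.
have /rootP-> : root (\prod_(z <- zs) ('X - z%:P)) w by rewrite root_prod_XsubC.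
by rewrite mulr0.
Qed.

(* Up to the factor p.[w], the roots of the polynomial below are the images of
   the roots of p by the coordinate y |-> 1 / (y - w) of the projective line;
   w being a non-root of p, they are all finite. *)
Definition mobius_poly (N : nat) (w : C) p : {poly C} :=
  \sum_(l < N.+1) p`_l *: ((w *: 'X + 1) ^+ l * 'X^(N - l)).

(** Infinity goes to 0. So does [w] itself, by the convention on the inverse of 0, hence the care
    taken to avoid [Some w]. *)
Definition mobius (w : C) (x : option C) : C := if x is Some z then (z - w)^-1 else 0.

(** Since [mobius_poly N w p] is [X^N p(w + 1/X)], the factor [X - z] contributes
    [X (w + 1/X - z)]. *)
Lemma mobius_poly_mulXsub N w z p : (size p <= N.+1)%N ->
  mobius_poly N.+1 w (('X - z%:P) * p) = ((w - z) *: 'X + 1) * mobius_poly N w p.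
Proof.
move=> sp.
have hX : mobius_poly N.+1 w ('X * p) = (w *: 'X + 1) * mobius_poly N w p.
  rewrite /mobius_poly big_ord_recl coefXM scale0r add0r mulr_sumr.
  apply: eq_bigr => l _; rewrite coefXM/= subSS exprS -!scalerAr.
  by rewrite mulrA.
have h1 : mobius_poly N.+1 w p = 'X * mobius_poly N w p.
  rewrite /mobius_poly big_ord_recr/= nth_default// scale0r addr0 mulr_sumr.
  apply: eq_bigr => l _; rewrite -scalerAr subSn ?exprS; last by rewrite -ltnS.
  by rewrite mulrCA.
transitivity (mobius_poly N.+1 w ('X * p) - z *: mobius_poly N.+1 w p).
  rewrite /mobius_poly scaler_sumr -sumrB; apply: eq_bigr => l _.
  by rewrite mulrBl coefB coefCM scalerBl scalerA.
by rewrite hX h1 scalerAl -mulrBl scalerBl addrAC.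
Qed.

Lemma mobius_poly_prod N w zs : (size zs <= N)%N ->
  mobius_poly N w (\prod_(z <- zs) ('X - z%:P)) =
  \prod_(z <- zs) ((w - z) *: 'X + 1) * 'X^(N - size zs).
Proof.
elim: zs N => [|z zs IH] [|N]//= sN.
- by rewrite !big_nil /mobius_poly big_ord1 coef1 !expr0 scale1r.
- rewrite !big_nil /mobius_poly big_ord_recl coef1 scale1r expr0 big1 ?addr0//.
  by move=> l _; rewrite coef1 scale0r.
by rewrite !big_cons mobius_poly_mulXsub ?size_prod_XsubC ?ltnS// IH// mulrA.
Qed.

(** Each factor [(w - z) X + 1] is [w - z] times a monic factor of root [1 / (z - w)], and the
    constants gather into [p.[w]]. The roots at infinity account for the powers of [X]. *)
Lemma mobius_roots N p es w : projective_roots N p es -> p.[w] != 0 ->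
  \prod_(x <- es) ('X - (mobius w x)%:P) = (p.[w])^-1 *: mobius_poly N w p.
Proof.
move=> pes pw; apply: (scalerI pw); rewrite scalerA divff// scale1r.
have := projective_roots_neq pes pw.
case: pes => c [zs [c0 pE szs esE]]; rewrite (perm_mem esE) mem_cat negb_or => /andP[wz _].
rewrite (perm_big _ esE) big_cat big_map/=.
have -> : \prod_(i <- nseq (N - size zs) None) ('X - (mobius w i)%:P) = 'X^(N - size zs).
  by elim: (N - size zs)%N => [|m IH]; rewrite ?big_nil ?expr0//= big_cons IH exprS subr0.
have -> : mobius_poly N w p = c *: mobius_poly N w (\prod_(z <- zs) ('X - z%:P)).
  rewrite /mobius_poly pE scaler_sumr; apply: eq_bigr => l _.
  by rewrite coefZ scalerA.
rewrite mobius_poly_prod// pE hornerZ -scalerA scalerAl horner_prod; congr (_ *: (_ * _)).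
elim: zs wz {pE szs esE} => [|z zs IH]; first by rewrite !big_nil scale1r.
rewrite map_cons inE negb_or => /andP[wz /IH {}IH].
have wz0 : w - z != 0 by rewrite subr_eq0; apply: contra wz => /eqP->.
rewrite !big_cons hornerXsubC -scalerA [X in _ *: X]scalerAr IH scalerAl; congr (_ * _).
rewrite scalerBr; congr (_ + _); rewrite -polyC1 -[_ *: _%:P]mul_polyC -polyCM -polyCN.
have wzE : (w - z) * (z - w)^-1 = -1.
  by rewrite -[w - z]opprB mulNr divff// -opprB oppr_eq0.
by congr (_%:P); rewrite wzE opprK.
Qed.

Lemma coef_comp_scaleX p u l : (p \Po (u *: 'X))`_l = u ^+ l * p`_l.
Proof.
rewrite comp_polyE (eq_bigr (fun i : 'I_(size p) => (p`_i * u ^+ i) *: 'X^i)).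
  rewrite -(poly_def (size p) (fun i => p`_i * u ^+ i)) coef_poly.
  by rewrite [RHS]mulrC; case: ltnP => // ?; rewrite nth_default ?mul0r.
by move=> i _; rewrite exprZn scalerA.
Qed.

Lemma projective_roots_scale N p es c u : c != 0 -> u != 0 -> projective_roots N p es ->
  projective_roots N (c *: (p \Po (u *: 'X))) [seq omap (fun z => z / u) x | x <- es].
Proof.
move=> c0 u0 [b [zs [b0 pE szs esE]]].
exists (c * b * u ^+ size zs), [seq z / u | z <- zs]; split.
- by rewrite !mulf_neq0// expf_neq0.
- rewrite pE comp_polyZ scalerA -[in RHS]scalerA; congr (_ *: _).
  rewrite big_map; elim: zs {pE szs esE} => [|z zs IH].
    by rewrite !big_nil comp_polyC scale1r.
  rewrite !big_cons rmorphM/= IH exprS -scalerA [X in _ = _ *: X]scalerAr scalerAl.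
  congr (_ * _).
  rewrite comp_polyB comp_polyX comp_polyC scalerBr -[_ *: _%:P]mul_polyC -polyCM.
  by rewrite mulrCA divff// mulr1.
- by rewrite size_map.
- rewrite size_map (perm_trans (perm_map _ esE))// map_cat map_nseq -!map_comp.
  exact: perm_refl.
Qed.

End PolynomialRoots.

Lemma projective_selection (R : realType) (N : nat) (Q : R -> {poly Cplx R})
    (E : R -> seq (option (Cplx R))) (w : Cplx R) (e1 : R) :
  (forall t, (size (Q t) <= N.+1)%N) ->
  (forall t : R, 0 <= t < e1 -> projective_roots N (Q t) (E t)) ->
  (forall t : R, 0 <= t < e1 -> (Q t).[w] != 0) ->
  (forall t0 : R, 0 <= t0 < e1 -> forall l,
    (Q t)`_l @[t --> within [set t : R | 0 <= t] (nbhs t0)] --> (Q t0)`_l) ->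
  exists s : R -> 'S_N, forall t0 : R, 0 <= t0 < e1 -> forall i,
    mobius w (nth None (E t) (s t i)) @[t --> within [set t : R | 0 <= t] (nbhs t0)]
    --> mobius w (nth None (E t0) (s t0 i)).
Proof.
move=> sQ QE Qw Qcvg.
have [s sP] := continuous_root_selection
  (fun t (i : 'I_N) => mobius w (nth None (E t) i)).
exists s => t0 /[dup] t0P /andP[t0_ge0 t0e1] i; apply: (sP t0 t0_ge0) => k.
have prodE (t : R) : 0 <= t < e1 ->
    (\prod_(i < N) ('X - (mobius w (nth None (E t) i))%:P))`_k =
    (Q t).[w]^-1 * (mobius_poly N w (Q t))`_k.
  move=> tP; rewrite -coefZ -(mobius_roots (QE _ tP) (Qw _ tP)).
  by rewrite (big_nth None) big_mkord (size_projective_roots (QE _ tP)).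
rewrite prodE//.
have : (Q t).[w]^-1 * (mobius_poly N w (Q t))`_k
    @[t --> within [set t : R | 0 <= t] (nbhs t0)]
    --> (Q t0).[w]^-1 * (mobius_poly N w (Q t0))`_k.
  apply: cvgM.
    apply: cvgV; first exact: Qw.
    exact: (@cvg_horner (Cplx R) R _ _ Q (Q t0) N.+1 w sQ (sQ t0) (Qcvg t0 t0P)).
  have mobE t : (mobius_poly N w (Q t))`_k =
      \sum_(l < N.+1) (Q t)`_l * ((w *: 'X + 1) ^+ l * 'X^(N - l))`_k.
    by rewrite /mobius_poly coef_sum; apply: eq_bigr => l _; rewrite coefZ.
  rewrite mobE (funext mobE).
  by apply: cvg_sumr => l _; apply: cvgM; [exact: Qcvg|exact: cvg_cst].
apply: cvg_trans; apply: near_eq_cvg; rewrite near_withinE.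
near=> t => /= t_ge0; rewrite prodE// t_ge0/=.
by near: t; exact: lt_nbhsl.
Unshelve. all: by end_near. Qed.

(** * Branches of eigenvalues *)

Section EigenvalueBranches.
Variable R : realType.
Local Notation C := (Cplx R).
Implicit Types (f Y : R -> C) (L : R -> option C).

Lemma normRM (x y : C) : normR (x * y) = normR x * normR y.
Proof.
apply: (@complexI R); rewrite rmorphM /= -!/(cplx_of_real _) -!normRE.
exact: normrM.
Qed.

(** Convergence after scaling bounds [|f e|] by [K e^r]. *)
Lemma in_germ_ring_scaled f (r e1 : R) (a : C) : 0 < e1 ->
  (forall t : R, 0 < t < e1 -> f e @[e --> t] --> f t) ->
  cplx_of_real (e `^ (- r)) * f e @[e --> 0^'+] --> a -> in_germ_ring f.
Proof.
move=> e1_gt0 fcont fa.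
pose K := normR a + 1.
have K_gt0 : 0 < K by rewrite ltr_wpDl// normR_ge0.
have [e2 e2_gt0 e2P] : exists2 e2 : R, 0 < e2 &
    forall e, 0 < e < e2 -> normR (cplx_of_real (e `^ (- r)) * f e) <= K.
  apply: near_rightP; move/cvgrPdist_lt: fa => /(_ (cplx_of_real 1)).
  rewrite (ltc_of_real 0 1) => /(_ ltr01); apply: filterS => e.
  rewrite normR_lt normR_distC /K => lt1.
  have := normR_distD a (cplx_of_real (e `^ (- r)) * f e) 0; rewrite !subr0.
  by move=> /le_trans; apply; rewrite addrC lerD2l ltW.
(* Below 1, [e^r] is at most [e^(-|r|)]; below [1 / K], [K] is at most [1 / e]. Together they give
   the exponent [|r| + 1]. *)
pose e0 := Order.min (Order.min e1 e2) (Order.min 1 K^-1).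
have e0P e : 0 < e < e0 -> [/\ 0 < e, e < e1, e < e2, e < 1 & e < K^-1].
  by rewrite /e0 !lt_min => /andP[? /andP[/andP[? ?] /andP[? ?]]].
exists e0, (`|r| + 1); split.
- by rewrite !lt_min e1_gt0 e2_gt0 ltr01 invr_gt0.
- by rewrite ltr_wpDl.
- by move=> t; rewrite in_itv/= => /e0P[t0 t1 _ _ _]; apply: fcont; rewrite t0.
move=> e; rewrite in_itv/= => /e0P[e_gt0 _ ee2 e_lt1 eK].
have normM (x : R) (z : C) : 0 <= x -> normR (cplx_of_real x * z) = x * normR z.
  move=> x0; rewrite normRM; congr (_ * _).
  by rewrite /normR normr_cplx_of_real ger0_norm.
have : normR (cplx_of_real (e `^ (- r)) * f e) <= K by apply: e2P; rewrite e_gt0.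
rewrite normM ?powR_ge0// powRN ler_pdivrMl ?powR_gt0// => fK.
rewrite normRE lec_of_real (le_trans fK)// opprD powR_add_gt0// powR_inv1 ?(ltW e_gt0)//.
apply: ler_pM; rewrite ?powR_ge0 ?(ltW K_gt0)//; last first.
  by rewrite -[K]invrK lef_pV2 ?posrE ?invr_gt0// ltW.
have {1}-> : r = - `|r| + (`|r| + r) by ring.
rewrite powR_add_gt0// ler_piMr ?powR_ge0//.
have r_ge0 : 0 <= `|r| + r by rewrite -lerBlDr sub0r -normrN ler_norm.
rewrite [leRHS](_ : 1 = 1 `^ (`|r| + r)); last by rewrite powR1.
by apply: ge0_ler_powR => //; rewrite ?nnegrE ltW.
Qed.

Lemma near_right_within (P : R -> Prop) :
  (\forall t \near within [set t : R | 0 <= t] (nbhs 0), P t) -> \forall t \near 0^'+, P t.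
Proof.
by rewrite /at_right !near_withinE; apply: filterS => t Pt t0; apply: Pt; exact: ltW.
Qed.

Lemma cvg_right_within (f : R -> C) (l : C) :
  f t @[t --> within [set t : R | 0 <= t] (nbhs 0)] --> l -> f t @[t --> 0^'+] --> l.
Proof. by apply: cvg_trans => P /near_right_within. Qed.

Lemma cvg_within_interior (f : R -> C) (l : C) (t0 : R) : 0 < t0 ->
  f t @[t --> within [set t : R | 0 <= t] (nbhs t0)] --> l -> f t @[t --> t0] --> l.
Proof.
move=> t0_gt0; apply: cvg_trans => P; rewrite /= !near_simpl near_withinE => Pt.
near=> t; have : [set t : R | 0 <= t] t.
  by rewrite /= ltW//; near: t; exact: lt_nbhsr.
by near: t.
Unshelve. all: by end_near. Qed.

(* Y is the branch L read in the coordinate 1 / (e^-g y - w). *)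
Section Coordinate.
Variables (g e1 : R) (w : C) (L : R -> option C) (Y : R -> C).
Let u (t : R) : C := cplx_of_real (t `^ g).
Hypothesis e1_gt0 : 0 < e1.
Hypothesis YL : forall t : R, 0 < t < e1 ->
  [/\ omap (fun z => z / u t) (L t) != Some w,
      Y t = mobius w (omap (fun z => z / u t) (L t)) & Y e @[e --> t] --> Y t].

Let u_neq0 (t : R) : 0 < t -> u t != 0 := @cplx_powR_neq0 R t g.

Let uN (t : R) : 0 < t -> cplx_of_real (t `^ (- g)) = (u t)^-1.
Proof. by move=> t0; rewrite powRN /u /cplx_of_real fmorphV. Qed.

Let u_cont (t : R) (x : R) : 0 < t -> cplx_of_real (e `^ x) @[e --> t] --> cplx_of_real (t `^ x).
Proof. by move=> t0; apply: cvg_cplx_of_real; exact: powR_continuous_at. Qed.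

Lemma branch_finite (l : C) : l != w -> Y e @[e --> 0^'+] --> mobius w (Some l) ->
  exists f, [/\ in_germ_ring f, \forall e \near 0^'+, L e = Some (f e) & simeq f l g%:E].
Proof.
(* Solving [Y = 1 / (y / u - w)] for [y]; the limit of [Y] is non-zero, so [L] is finite near 0. *)
move=> lw Yl; pose f t := u t * (w + (Y t)^-1).
have lw0 : l - w != 0 by rewrite subr_eq0.
have Y0 : \forall e \near 0^'+, Y e != 0.
  move/cvgrPdist_lt : Yl => /(_ `|(l - w)^-1|); rewrite normr_gt0 invr_eq0 => /(_ lw0).
  by apply: filterS => e; apply: contraTneq => ->; rewrite subr0 ltxx.
have [e2 e2_gt0 e2P] := near_rightP Y0.
have fl : cplx_of_real (e `^ (- g)) * f e @[e --> 0^'+] --> l.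
  have : w + (Y e)^-1 @[e --> 0^'+] --> w + (mobius w (Some l))^-1.
    apply: cvgD; first exact: cvg_cst.
    by apply: cvgV; [rewrite invr_eq0|exact: Yl].
  rewrite /= invrK subrKC; apply: cvg_trans; apply: near_eq_cvg; near=> e.
  have e0 : 0 < e by near: e; exact: nbhs_right_gt.
  by rewrite uN// /f mulrA mulVf ?mul1r// u_neq0.
exists f; split => //.
- apply: (@in_germ_ring_scaled f g (Order.min e1 e2) l _ _ fl).
    by rewrite lt_min e1_gt0.
  move=> t; rewrite lt_min => /andP[t0 /andP[t1 t2]].
  have [|_ _ Yt] := YL (t := t); first by rewrite t0.
  apply: cvgM; first exact: u_cont.
  apply: cvgD; first exact: cvg_cst.
  by apply: cvgV; [apply: e2P; rewrite t0|exact: Yt].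
near=> t.
have t0 : 0 < t by near: t; exact: nbhs_right_gt.
have Yt0 : Y t != 0 by near: t.
have [|Lw YE _] := YL (t := t).
  by rewrite t0/=; near: t; exact: nbhs_right_lt.
move: Yt0; rewrite /f YE; case: (L t) => [z|] /=; last by rewrite eqxx.
by move=> _; rewrite invrK subrKC mulrC divfK// u_neq0.
Unshelve. all: by end_near. Qed.

Lemma branch_infinite : Y e @[e --> 0^'+] --> (0 : C) -> branch_large L g.
Proof.
(* This is the inverse of the eigenvalue in terms of [Y], valid also where [Y] is 0 and [L]
   infinite. The denominator vanishes exactly when the eigenvalue is 0. *)
move=> Yl; pose f t := cplx_of_real (t `^ (- g)) * (Y t / (1 + w * Y t)).
have den1 : 1 + w * Y e @[e --> 0^'+] --> (1 : C).
  rewrite -[X in _ --> X]addr0 -[X in _ --> _ + X](mulr0 w).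
  by apply: cvgD; [exact: cvg_cst|apply: cvgM; [exact: cvg_cst|exact: Yl]].
have den0 : \forall e \near 0^'+, 1 + w * Y e != 0.
  move/cvgrPdist_lt : den1 => /(_ 1 ltr01).
  by apply: filterS => e; apply: contraTneq => ->; rewrite subr0 normr1 ltxx.
have [e2 e2_gt0 e2P] := near_rightP den0.
have fl : cplx_of_real (e `^ (- - g)) * f e @[e --> 0^'+] --> (0 : C).
  have : Y e / (1 + w * Y e) @[e --> 0^'+] --> (0 / 1 : C).
    by apply: cvgM; [exact: Yl|apply: cvgV; [exact: oner_neq0|exact: den1]].
  rewrite mul0r; apply: cvg_trans; apply: near_eq_cvg; near=> e.
  have e0 : 0 < e by near: e; exact: nbhs_right_gt.
  by rewrite /f uN// opprK mulrA divff ?mul1r// u_neq0.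
exists f; split => //.
- apply: (@in_germ_ring_scaled f (- g) (Order.min e1 e2) 0 _ _ fl).
    by rewrite lt_min e1_gt0.
  move=> t; rewrite lt_min => /andP[t0 /andP[t1 t2]].
  have [|_ _ Yt] := YL (t := t); first by rewrite t0.
  apply: cvgM; first exact: u_cont.
  apply: cvgM; first exact: Yt.
  apply: cvgV; first by apply: e2P; rewrite t0.
  apply: cvgD; first exact: cvg_cst.
  by apply: cvgM; [exact: cvg_cst|exact: Yt].
near=> t.
have t0 : 0 < t by near: t; exact: nbhs_right_gt.
have : 1 + w * Y t != 0 by near: t.
have [|Lw YE _] := YL (t := t).
  by rewrite t0/=; near: t; exact: nbhs_right_lt.
rewrite /f YE uN//; case: (L t) Lw => [z|] /= Lw dn; last by rewrite mul0r mulr0.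
have {Lw} zw : z / u t - w != 0 by rewrite subr_eq0; apply: contra Lw => /eqP->.
have ut0 := u_neq0 t0.
have dE : 1 + w * (z / u t - w)^-1 = (z / u t) / (z / u t - w).
  by rewrite -{1}(divff zw) -mulrDl subrK.
have z0 : z != 0 by apply: contra dn => /eqP z0; rewrite dE z0 !mul0r.
rewrite (negPf z0) dE; congr Some.
move: (z / u t - w) zw => v v0; move: (u t) ut0 => b b0.
by field; rewrite v0 b0 z0.
Unshelve. all: by end_near. Qed.

End Coordinate.

Lemma simeq_unique L f1 f2 (a1 a2 : C) (g : R) :
  (\forall e \near 0^'+, L e = Some (f1 e)) -> (\forall e \near 0^'+, L e = Some (f2 e)) ->
  simeq f1 a1 g%:E -> simeq f2 a2 g%:E -> a1 = a2.
Proof.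
rewrite /simeq => L1 L2 fa1 fa2.
have fa1' : cplx_of_real (e `^ (- g)) * f1 e @[e --> 0^'+] --> a2.
  move: fa2; apply: cvg_trans; apply: near_eq_cvg; near=> e.
  by congr (_ * _); apply: Some_inj; rewrite -(near L1 e)// -(near L2 e).
exact: cvg_unique fa1 fa1'.
Unshelve. all: by end_near. Qed.

(** The scaled branch and its scaled inverse have product 1 near 0, whereas their limits have
    product 0. *)
Lemma branch_large_infinite L f (a : C) (g : R) :
  (\forall e \near 0^'+, L e = Some (f e)) -> simeq f a g%:E -> ~ branch_large L g.
Proof.
rewrite /branch_large /branch_small /simeq => Lf fa [h [_ Lh ha]].
have lim1 : cst (1 : C) e @[e --> (0 : R)^'+] --> a * 0.
  have prodcvg : cplx_of_real (e `^ (- g)) * f e * (cplx_of_real (e `^ (- - g)) * h e)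
      @[e --> 0^'+] --> a * 0.
    exact: (cvgM fa ha).
  apply: (cvg_trans _ prodcvg); apply: near_eq_cvg; near=> e.
  have e0 : 0 < e by near: e; exact: nbhs_right_gt.
  have : proj_inv (L e) = Some (h e) by near: e.
  rewrite (near Lf e)//=; case: eqP => // /eqP fe0 [<-].
  rewrite /= mulrACA divff// mulr1 -cplx_of_realM -powR_add_gt0// opprK addNr powRr0.
  by [].
have /eqP : a * 0 = 1.
  apply: (cvg_unique _ lim1); [exact: norm_hausdorff|exact: cvg_cst].
by rewrite mulr0 eq_sym oner_eq0.
Unshelve. all: by end_near. Qed.

End EigenvalueBranches.

(** * Multiplicities *)

Section Eigenvalues.
Variables (R : realType) (n d : nat).
Local Notation C := (Cplx R).
Implicit Type b : 'I_d.+1 -> 'M[C]_n.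

Lemma size_proots_charp b : regular b -> (size (proots (charp b)) <= n * d)%N.
Proof.
move=> breg; rewrite size_proots// /poly_deg -ltnS.
by rewrite prednK ?size_charp// size_poly_gt0.
Qed.

Lemma projective_roots_charp b : regular b ->
  projective_roots (n * d) (charp b) (eigenvalues b).
Proof.
move=> breg; exists (lead_coef (charp b)), (proots (charp b)); split.
- by rewrite lead_coef_eq0.
- exact: proots_factor.
- exact: size_proots_charp.
- by rewrite /eigenvalues size_proots.
Qed.

Lemma size_eigenvalues b : regular b -> size (eigenvalues b) = (n * d)%N.
Proof. by move=> /projective_roots_charp/size_projective_roots. Qed.

Lemma count_zero_eigenvalues b : regular b ->
  count_mem (Some 0) (eigenvalues b) = poly_val (charp b).
Proof.
move=> breg; rewrite /eigenvalues count_cat count_nseq mul0n addn0 count_map.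
by rewrite poly_val_proots//; apply: eq_count.
Qed.

Lemma count_infinite_eigenvalues b :
  count_mem None (eigenvalues b) = (n * d - poly_deg (charp b))%N.
Proof. by rewrite /eigenvalues count_cat count_nseq mul1n count_map count_pred0. Qed.

Lemma coef_charp_neq0 b l : (charp b)`_l != 0 ->
  exists (s : 'S_n) (k : {ffun 'I_n -> 'I_d.+1}),
    (\sum_i k i)%N = l /\ forall i, b (k i) i (s i) != 0.
Proof.
move=> bl; apply: contrapT => nex; move/eqP: bl; apply.
rewrite coef_charp big1// => s _; rewrite big1// => k /eqP kl.
suff /eqP-> : \prod_i b (k i) i (s i) == 0 by rewrite mulr0.
apply: contrapT => /negP prod0; apply: nex; exists s, k; split=> // i.
by move/prodf_neq0: prod0; apply.
Qed.

Variable A : 'I_d.+1 -> 'M[\bar R]_n.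
Hypothesis A_gtNy : forall k i j, A k i j != -oo%E.

Lemma count_pinfty_le b :
  (forall l, nth +oo%E (mp_charp A) l = +oo%E -> (charp b)`_l = 0) ->
  mp_regular A -> regular b ->
  (mp_val (mp_charp A) <= poly_val (charp b))%N /\
  (count_mem +oo%E (mp_eigenvalues A) <= count_mem (Some 0%R) (eigenvalues b))%N.
Proof.
move=> vanish Areg breg.
have le_val : (mp_val (mp_charp A) <= poly_val (charp b))%N.
  rewrite leqNgt; apply/negP => /(before_find +oo%E)/negbT; rewrite negbK => /eqP/vanish b0.
  have hb : has (fun c => c != 0) (charp b).
    apply/hasP; exists (lead_coef (charp b)); last by rewrite lead_coef_eq0.
    by rewrite lead_coefE; apply: mem_nth; rewrite prednK// size_poly_gt0.
  by have := nth_find 0 hb; rewrite -/(poly_val _) b0 eqxx.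
split=> //; rewrite count_zero_eigenvalues//; apply: leq_trans le_val.
rewrite /mp_eigenvalues count_cat count_nseq mul0n addn0.
have [->//|Pc] := mp_roots_spec (mp_charp A).
by apply: mp_factors_count_pinfty => //; exact: mp_charp_gtNy.
Qed.

Lemma count_ninfty_le b :
  (forall l, nth +oo%E (mp_charp A) l = +oo%E -> (charp b)`_l = 0) ->
  regular b ->
  (poly_deg (charp b) <= mp_deg (mp_charp A))%N /\
  (count_mem -oo%E (mp_eigenvalues A) <= count_mem None (eigenvalues b))%N.
Proof.
move=> vanish breg.
have le_deg : (poly_deg (charp b) <= mp_deg (mp_charp A))%N.
  have ld : (poly_deg (charp b) < size (mp_charp A))%N.
    by rewrite size_mp_charp ltnS -size_proots// size_proots_charp.
  apply: (leq_bigmax_cond (Ordinal ld)) => /=; apply/eqP => /vanish/eqP.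
  by rewrite -lead_coefE lead_coef_eq0; exact/negP.
split=> //; rewrite count_infinite_eigenvalues /mp_eigenvalues count_cat count_nseq mul1n.
have -> : count_mem -oo%E (mp_roots (mp_charp A)) = 0%N.
  apply/eqP; rewrite -leqn0 leqNgt -has_count; apply/negP => /hasP[x].
  by move=> /(allP (mp_roots_gtNy _)) + /eqP xE; rewrite xE.
by rewrite add0n leq_sub2l.
Qed.

End Eigenvalues.

Section DominantCounts.
Variables (R : realType) (n d : nat).
Local Notation C := (Cplx R).
Variables (a : 'I_d.+1 -> 'M[C]_n) (A : 'I_d.+1 -> 'M[\bar R]_n).
Hypothesis hA : forall k i j, A k i j != -oo%E.
Variables (g : R) (G : rel 'I_n).
Hypothesis GP : G =2 Opt (mp_hat A g) \/
  exists U V, hungarian_pair (mp_hat A g) U V /\ G =2 Sat (mp_hat A g) U V.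
Local Notation ag := (dominant_coef a A g G).
Hypothesis agreg : regular ag.

(** A non-zero coefficient of the limit polynomial provides a permutation whose arcs all have
    entries below [+oo] in [mp_hat A g]. *)
Lemma dominant_per_fin : mp_per (mp_hat A g) \is a fin_num.
Proof.
have [s [k [_ sk]]] : exists (s : 'S_n) (k : {ffun 'I_n -> 'I_d.+1}),
    (\sum_i k i)%N = (size (charp ag)).-1 /\ forall i, ag (k i) i (s i) != 0.
  by apply: coef_charp_neq0; rewrite -lead_coefE lead_coef_eq0.
rewrite fin_numE; apply/andP; split.
  rewrite -ltNye; apply: lt_bigmin => // u _; rewrite ltNye.
  apply/negP => /eqP/esum_eqNyP[i [_ _]] /eqP; apply/negP; rewrite -ltNye mxE.
  apply: lt_bigmin => // j _.
  by have := hA j i (u i); case: (A j i (u i)) => //= r _; rewrite -EFinD ltNyr.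
rewrite -ltey; apply: le_lt_trans (mp_per_le _ s) _.
apply: lte_sum_pinfty => i _.
have := sk i; rewrite mxE; case: ifP; rewrite ?eqxx// => /andP[/andP[_ h] _] _.
by rewrite ltey.
Qed.

(** A non-zero coefficient of degree [l] comes from a term of weight equal to the permanent, so the
    monomial of degree [l] of [mp_charp A] attains the minimum at [g]. *)
Lemma dominant_counts l : g%:E \in mp_eigenvalues A -> (charp ag)`_l != 0 ->
  (count (fun x => g%:E < x)%E (mp_eigenvalues A) <= l <=
   count_mem g%:E (mp_eigenvalues A) +
   count (fun x => g%:E < x)%E (mp_eigenvalues A))%N.
Proof.
rewrite /mp_eigenvalues mem_cat mem_nseq andbF orbF => groot /coef_charp_neq0[s [k [kl sk]]].
rewrite !count_cat !count_nseq !mul0n !addn0 -count_ge_split.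
have [r0|Pc] := mp_roots_spec (mp_charp A); first by rewrite r0 in groot.
have perfin := dominant_per_fin.
have wE : hat_weight A g s k = mp_per (mp_hat A g).
  apply: (proj2 (hat_weight_eq perfin GP s k)) => i.
  by have := sk i; rewrite mxE; case: ifP; rewrite ?eqxx.
have ll : (l < size (mp_charp A))%N by rewrite size_mp_charp ltnS -kl sum_ffun_le.
have le_per : (nth +oo (mp_charp A) l + (l%:R * g)%:E <= mp_per (mp_hat A g))%E.
  by rewrite -wE hat_weightE kl leeD2r// -kl mp_charp_le.
have := allP (mp_charp_gtNy hA) _ (mem_nth +oo%E ll).
case PAl : (nth _ _ l) le_per => [v||]//= le_per _; last first.
  by have := le_lt_trans le_per (_ : _ < +oo)%E; rewrite ltxx ltey_eq perfin => /(_ isT).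
by apply: (mp_factors_count Pc ll PAl); rewrite EFinD (le_trans le_per)// mp_per_hat_le_eval.
Qed.

End DominantCounts.

Lemma cplx_powR_exp (R : realType) (t g : R) (l : nat) : 0 < t ->
  cplx_of_real (t `^ g) ^+ l = cplx_of_real (t `^ (l%:R * g)).
Proof.
move=> t0; elim: l => [|l IH]; first by rewrite expr0 mul0r powRr0.
by rewrite exprS IH -cplx_of_realM -powR_add_gt0// -natr1 mulrDl mul1r addrC.
Qed.

Lemma perm_projective_roots (R : realType) (N : nat) (p : {poly Cplx R})
    (es es' : seq (option (Cplx R))) :
  perm_eq es' es -> projective_roots N p es -> projective_roots N p es'.
Proof.
move=> es'es [c [zs [c0 pE szs esE]]]; exists c, zs; split=> //.
exact: perm_trans esE.
Qed.

(** * Branches of eigenvalues with a prescribed order in the limit *)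

Section Branches.
Variables (R : realType) (n d : nat).
Local Notation C := (Cplx R).
Variables (F : 'I_d.+1 -> R -> 'M[C]_n) (a : 'I_d.+1 -> 'M[C]_n).
Variable A : 'I_d.+1 -> 'M[\bar R]_n.
Hypothesis hF : forall k i j, in_germ_ring (fun e => F k e i j).
Hypothesis hA : forall k i j, A k i j != -oo%E.
Hypothesis hFa : forall k i j, simeq (fun e => F k e i j) (a k i j) (A k i j).
Variables (g : R) (G : rel 'I_n).
Hypothesis GP : G =2 Opt (mp_hat A g) \/
  exists U V, hungarian_pair (mp_hat A g) U V /\ G =2 Sat (mp_hat A g) U V.
Local Notation ag := (dominant_coef a A g G).
Hypothesis agreg : regular ag.
Local Notation N := (n * d)%N.
Local Notation Fe t := (fun k => F k t).

Let p : R := fine (mp_per (mp_hat A g)).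
Let u (t : R) : C := cplx_of_real (t `^ g).

(** The limit polynomial is the value at 0, which makes the coefficients continuous from the right
    there. *)
Definition scaled_charp (t : R) : {poly C} :=
  if 0 < t then cplx_of_real (t `^ (- p)) *: (charp (Fe t) \Po (u t *: 'X)) else charp ag.

Lemma coef_scaled_charp t l : 0 < t ->
  (scaled_charp t)`_l = cplx_of_real (t `^ scaling_exp A g l) * (charp (Fe t))`_l.
Proof.
move=> t0; rewrite /scaled_charp t0 coefZ coef_comp_scaleX mulrA cplx_powR_exp//.
by rewrite -cplx_of_realM -powR_add_gt0// addrC.
Qed.

Lemma size_scaled_charp t : (size (scaled_charp t) <= N.+1)%N.
Proof.
have [t0|t0] := ltP 0 t; last by rewrite /scaled_charp ltNge t0 size_charp.
apply/leq_sizeP => l Nl; rewrite coef_scaled_charp//.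
by rewrite (nth_default _ (leq_trans (size_charp _) Nl)) mulr0.
Qed.

Lemma scaled_charp_cvg0 l :
  (scaled_charp t)`_l @[t --> within [set t : R | 0 <= t] (nbhs 0)] --> (scaled_charp 0)`_l.
Proof.
have Qcvg : (scaled_charp t)`_l @[t --> 0^'+] --> (charp ag)`_l.
  have cvg0 := scaled_coef_cvg hA hFa (dominant_per_fin hA agreg) GP (l := l).
  apply: (cvg_trans _ cvg0); apply: near_eq_cvg; near=> t.
  by rewrite coef_scaled_charp//; near: t; exact: nbhs_right_gt.
rewrite {2}/scaled_charp ltxx; apply/cvgrPdist_lt => e e0.
move/cvgrPdist_lt : Qcvg => /(_ e e0); rewrite /at_right !near_withinE.
apply: filterS => t tlt; rewrite /= le_eqVlt => /predU1P[<-|]; last exact: tlt.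
by rewrite /scaled_charp ltxx subrr normr0.
Unshelve. all: by end_near. Qed.

Lemma scaled_charp_continuous : \forall t \near 0^'+, forall l,
  (scaled_charp e)`_l @[e --> t] --> (scaled_charp t)`_l.
Proof.
have := coef_charp_continuous hF; apply: filterS2 (near_right_gt0 R) => t t0 Ft l.
rewrite coef_scaled_charp//.
have cvgt : cplx_of_real (e `^ scaling_exp A g l) * (charp (Fe e))`_l @[e --> t]
    --> cplx_of_real (t `^ scaling_exp A g l) * (charp (Fe t))`_l.
  apply: cvgM; last exact: Ft.
  by apply: cvg_cplx_of_real; exact: powR_continuous_at.
apply: (cvg_trans _ cvgt); apply: near_eq_cvg; near=> e.
by rewrite coef_scaled_charp//; near: e; exact: lt_nbhsr.
Unshelve. all: by end_near. Qed.

Lemma scaled_charp_regular t : 0 < t -> scaled_charp t != 0 -> regular (Fe t).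
Proof.
move=> t0; apply: contra => /eqP charp0.
by rewrite /scaled_charp t0 charp0 comp_poly0 scaler0.
Qed.

Lemma eigenvalue_branches (T0 : seq (option C)) : perm_eq T0 (eigenvalues ag) ->
  exists L : 'I_N -> R -> option C,
    (\forall e \near 0^'+, regular (Fe e) /\
       perm_eq [seq L i e | i <- enum 'I_N] (eigenvalues (Fe e))) /\
    forall i : 'I_N, match nth None T0 i with
      | Some l => exists f, [/\ in_germ_ring f, \forall e \near 0^'+, L i e = Some (f e) &
                     simeq f l g%:E]
      | None => branch_large (L i) g
      end.
Proof.
move=> T0E; have [w w0] := ex_nonroot agreg.
have Q0 : scaled_charp 0 = charp ag by rewrite /scaled_charp ltxx.
have Qw : \forall t \near 0^'+, (scaled_charp t).[w] != 0.
  have Qw0 : (scaled_charp t).[w] @[t --> within [set t : R | 0 <= t] (nbhs 0)]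
      --> (scaled_charp 0).[w].
    exact: (@cvg_horner C R _ _ scaled_charp (scaled_charp 0) N.+1 w
      size_scaled_charp (size_scaled_charp 0) scaled_charp_cvg0).
  have /cvgrPdist_lt := cvg_right_within Qw0.
  move=>/(_ `|(scaled_charp 0).[w]|).
  rewrite Q0 normr_gt0 => /(_ w0).
  by apply: filterS => t; apply: contraTneq => ->; rewrite subr0 ltxx.
have [e1 e1_gt0 e1P] := near_rightP (filterI Qw scaled_charp_continuous).
pose E t := if 0 < t then [seq omap (fun z => z / u t) x | x <- eigenvalues (Fe t)] else T0.
have QwP (t : R) : 0 <= t < e1 -> (scaled_charp t).[w] != 0.
  move=> /andP[]; rewrite le_eqVlt => /predU1P[<- _|t0 t1]; first by rewrite Q0.
  by have [|//] := e1P t; rewrite t0.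
have regP (t : R) : 0 < t < e1 -> regular (Fe t).
  move=> /andP[t0 t1]; apply: scaled_charp_regular => //.
  have : (scaled_charp t).[w] != 0 by apply: QwP; rewrite ltW.
  by apply: contraNneq => ->; rewrite horner0.
have QE (t : R) : 0 <= t < e1 -> projective_roots N (scaled_charp t) (E t).
  move=> /andP[]; rewrite le_eqVlt => /predU1P[<- _|t0 t1].
    rewrite Q0 /E ltxx; apply: (perm_projective_roots T0E).
    exact: projective_roots_charp.
  rewrite /E /scaled_charp t0; apply: projective_roots_scale; rewrite ?cplx_powR_neq0//.
  by apply: projective_roots_charp; apply: regP; rewrite t0.
have Qcvg (t0 : R) : 0 <= t0 < e1 -> forall l,
    (scaled_charp t)`_l @[t --> within [set t : R | 0 <= t] (nbhs t0)]
    --> (scaled_charp t0)`_l.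
  move=> /andP[]; rewrite le_eqVlt => /predU1P[<- _ l|t0_gt0 t0_lt l].
    exact: scaled_charp_cvg0.
  by apply: cvg_within_filter; have [|_] := e1P t0; rewrite ?t0_gt0.
have [s sP] := projective_selection size_scaled_charp QE QwP Qcvg.
(* Normalized to be the identity at 0, so that branch [i] starts at entry [i] of [T0]. *)
pose r t : 'S_N := ((s 0)^-1 * s t)%g.
pose L (i : 'I_N) t := nth None (eigenvalues (Fe t)) (r t i).
pose Y (i : 'I_N) t := mobius w (nth None (E t) (r t i)).
have rE t i : r t i = s t ((s 0)^-1%g i) by rewrite /r permM.
have YL (i : 'I_N) (t : R) : 0 < t < e1 -> [/\ omap (fun z => z / u t) (L i t) != Some w,
    Y i t = mobius w (omap (fun z => z / u t) (L i t)) & Y i e @[e --> t] --> Y i t].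
  move=> t01; have /andP[t0 t1] := t01.
  have t01' : 0 <= t < e1 by rewrite ltW.
  have rt : (r t i < size (eigenvalues (Fe t)))%N by rewrite (size_eigenvalues (regP t t01)).
  have EL : nth None (E t) (r t i) = omap (fun z => z / u t) (L i t).
    by rewrite /E t0 (nth_map None).
  split.
  - rewrite -EL; apply: contra (projective_roots_neq (QE t t01') (QwP t t01')) => /eqP <-.
    by apply: mem_nth; rewrite (size_projective_roots (QE t t01')).
  - by rewrite -EL.
  - have := sP t t01' ((s 0)^-1%g i) => /(cvg_within_interior t0).
    by rewrite /Y rE; under eq_fun do rewrite -rE.
have Y0 i : Y i e @[e --> 0^'+] --> mobius w (nth None T0 i).
  have := sP 0 _ ((s 0)^-1%g i); rewrite lexx e1_gt0 => /(_ isT)/cvg_right_within.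
  by rewrite permKV {2}/E ltxx /Y; under eq_fun do rewrite -rE.
exists L; split.
  near=> t; have t01 : 0 < t < e1.
    by apply/andP; split; near: t; [exact: nbhs_right_gt|exact: nbhs_right_lt].
  split; first exact: regP.
  have sz : size (eigenvalues (Fe t)) == N by rewrite (size_eigenvalues (regP t t01)).
  apply/(@tuple_permP _ _ _ (Tuple sz)); exists (r t).
  by apply: eq_map => i; rewrite (tnth_nth None).
move=> i; have := Y0 i; case T0i: (nth None T0 i) => [l|] Yl; last first.
  exact: (branch_infinite e1_gt0 (YL i) Yl).
apply: (branch_finite e1_gt0 (YL i) _ Yl).
have iT0 : (i < size T0)%N by rewrite (perm_size T0E) size_eigenvalues.
have T0w : Some w \notin T0.
  rewrite (perm_mem T0E).
  exact: (projective_roots_neq (projective_roots_charp agreg) w0).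
apply: contra T0w => /eqP <-; rewrite -T0i; exact: mem_nth.
Unshelve. all: by end_near. Qed.

End Branches.

Lemma card_nth_eq (T : eqType) (N : nat) (x0 x : T) (s : seq T) : size s = N ->
  #|[set i : 'I_N | nth x0 s i == x]%SET| = count_mem x s.
Proof.
move=> sN; rewrite cardsE -sum1_card -sum1_count (big_nth x0) sN big_mkord.
exact: eq_bigl.
Qed.

Lemma sorted_eigenvalues (R : realType) (n d : nat) (b : 'I_d.+1 -> 'M[Cplx R]_n) :
  regular b ->
  perm_eq (map Some (nonzero_eigenvalues b) ++
           (nseq (poly_val (charp b)) (Some 0) ++ nseq (n * d - poly_deg (charp b)) None))
    (eigenvalues b).
Proof.
move=> breg; rewrite catA perm_cat2r -map_nseq -map_cat; apply: perm_map.
rewrite perm_sym -(perm_filterC (fun z : Cplx R => z != 0)) perm_cat2l.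
have /all_pred1P-> : all (pred1 (0 : Cplx R))
    [seq x <- proots (charp b) | predC (fun z : Cplx R => z != 0) x].
  by apply/allP => z; rewrite mem_filter /= negbK => /andP[].
rewrite size_filter poly_val_proots// (eq_count (a2 := pred1 (0 : Cplx R)))//.
by move=> z /=; rewrite negbK.
Qed.

(** * Multiplicity inequalities and distribution of the branches *)

Unset Implicit Arguments.
Set Strict Implicit.

Theorem theorem8p2 (R : realType) (n d : nat)
    (F : 'I_d.+1 -> R -> 'M[Cplx R]_n)
    (a : 'I_d.+1 -> 'M[Cplx R]_n) (A : 'I_d.+1 -> 'M[\bar R]_n)
    (hF : forall k i j, in_germ_ring (fun e => F k e i j))
    (Freg : germ_regular F)
    (hA : forall k i j, A k i j != -oo%E)
    (hFa : forall k i j, simeq (fun e => F k e i j) (a k i j) (A k i j)) :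
  let Fe := fun (e : R) (k : 'I_d.+1) => F k e in
  let PA := mp_charp A in
  mp_regular A /\
  (\forall e \near 0^'+, regular (Fe e) ->
     (mp_val PA <= poly_val (charp (Fe e)))%N /\
     (count_mem +oo%E (mp_eigenvalues A)
        <= count_mem (Some (0 : Cplx R)%R) (eigenvalues (Fe e)))%N) /\
  (\forall e \near 0^'+, regular (Fe e) ->
     (poly_deg (charp (Fe e)) <= mp_deg PA)%N /\
     (count_mem -oo%E (mp_eigenvalues A)
        <= count_mem None (eigenvalues (Fe e)))%N) /\
  (forall (g : R) (G : rel 'I_n),
     g%:E \in mp_eigenvalues A ->
     (G =2 Opt (mp_hat A g) \/
      exists U V : 'rV[R]_n,
        hungarian_pair (mp_hat A g) U V /\ G =2 Sat (mp_hat A g) U V) ->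
     let ag := fun k : 'I_d.+1 =>
       mx_restrict (a k) (fun i j => mp_graph A g k i j && G i j) in
     regular ag ->
     let lambda := nonzero_eigenvalues ag in
     let m := size lambda in
     let mA := count_mem g%:E (mp_eigenvalues A) in
     let m'A := count (fun x => (g%:E < x)%E) (mp_eigenvalues A) in
     let m''A := (n * d - mA - m'A)%N in
     let m' := poly_val (charp ag) in
     let m'' := (n * d - m - m')%N in
     [/\ (m <= mA)%N, (m'A <= m')%N, (m''A <= m'')%N &
       exists L : 'I_(n * d) -> R -> option (Cplx R),
         [/\ \forall e \near 0^'+, regular (Fe e) /\
               perm_eq [seq L i e | i <- enum 'I_(n * d)] (eigenvalues (Fe e)),
             exists h : 'I_m -> 'I_(n * d), injective h /\
               forall i : 'I_m, branch_first_order (L (h i)) lambda`_i g,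
             exists S : {set 'I_(n * d)}, #|S| = m' /\
               forall i, i \in S <-> branch_small (L i) g &
             exists S : {set 'I_(n * d)}, #|S| = m'' /\
               forall i, i \in S <-> branch_large (L i) g]]).
Proof.
move=> Fe PA; have vanish := coef_charp_near0 hA hFa.
have Areg := mp_charp_regular hA hFa Freg.
split; first exact: Areg.
split; first by move: vanish; apply: filterS => e v0 ereg; exact: count_pinfty_le.
split; first by move: vanish; apply: filterS => e v0 ereg; exact: count_ninfty_le.
move=> g G groot GP ag agreg lambda m mA m'A m''A m' m''.
have degE : (m + m')%N = poly_deg (charp ag) by exact: size_nonzero_proots.
have deg_le : (poly_deg (charp ag) <= n * d)%N.
  by rewrite -size_proots// size_proots_charp.
have deg_coef : (charp ag)`_(poly_deg (charp ag)) != 0.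
  by rewrite -lead_coefE lead_coef_eq0.
have hag : has (fun c => c != 0) (charp ag).
  apply/hasP; exists (lead_coef (charp ag)); last by rewrite lead_coef_eq0.
  by rewrite lead_coefE; apply: mem_nth; rewrite prednK// size_poly_gt0.
have val_coef : (charp ag)`_m' != 0 by exact: (nth_find 0 hag).
(* The lowest degree gives [m'A <= m'] and the highest gives [m + m' <= mA + m'A]; the three
   inequalities follow. *)
have /andP[m'P _] := dominant_counts hA GP agreg groot val_coef.
have /andP[_ degP] := dominant_counts hA GP agreg groot deg_coef.
rewrite -/mA -/m'A in m'P degP.
have m''E : m'' = (n * d - poly_deg (charp ag))%N by rewrite /m'' -degE subnDA.
split=> //; [by lia | by rewrite m''E /m''A; lia | ].
(* The non-zero eigenvalues come first, so that branch [i] with [i < m] follows [lambda] at index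
   [i]. *)
have T0E := sorted_eigenvalues agreg.
set T0 := (_ ++ _) in T0E.
have sT0 : size T0 = (n * d)%N by rewrite (perm_size T0E) size_eigenvalues.
have [L [Leig LP]] := eigenvalue_branches hF hA hFa GP agreg T0E.
exists L; split=> //.
- have mle : (m <= n * d)%N by rewrite (leq_trans _ deg_le)// -degE leq_addr.
  exists (widen_ord mle); split=> [i j /(congr1 val)/= ij|i]; first exact: val_inj.
  have im : (widen_ord mle i < size (nonzero_eigenvalues ag))%N by exact: (ltn_ord i).
  have := LP (widen_ord mle i); rewrite /T0 nth_cat size_map im (nth_map 0)//.
  move=> [f [fg Lf fl]]; exists f; split=> //; split=> // _.
  have : lambda`_i \in lambda by exact: mem_nth.
  by rewrite mem_filter => /andP[].
- exists [set i : 'I_(n * d) | nth None T0 i == Some 0]%SET; split.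
    by rewrite card_nth_eq// (seq.permP T0E) count_zero_eigenvalues.
  (* The converse inclusion rests on uniqueness: a scaled branch has only one limit, and a branch
     with a finite one is not large. *)
  move=> i; rewrite finset.in_set; have := LP i; case: (nth None T0 i) => [l|] Li; split.
  + by move=> /eqP[l0]; move: Li; rewrite l0.
  + move=> [f2 [_ Lf2 fl2]]; have [f1 [_ Lf1 fl1]] := Li.
    by rewrite (simeq_unique Lf1 Lf2 fl1 fl2).
  + by move=> /eqP sl; discriminate sl.
  + by move=> [f [_ Lf fl]]; have := branch_large_infinite Lf fl Li.
- exists [set i : 'I_(n * d) | nth None T0 i == None]%SET; split.
    by rewrite card_nth_eq// (seq.permP T0E) count_infinite_eigenvalues.
  move=> i; rewrite finset.in_set; have := LP i; case: (nth None T0 i) => [l|] Li; split.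
  + by move=> /eqP sl; discriminate sl.
  + by move=> Ll; have [f [_ Lf fl]] := Li; have := branch_large_infinite Lf fl Ll.
  + by move=> _; exact: Li.
  + by move=> _; exact: eqxx.
Qed.
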